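(* Let $\lambda>0$ and let $(Y_t)_{t\ge0}$ be the $q/q/\infty$ queueing process with arrival rate $\lambda$ and service rate $1$, with semigroup $(T_t)_{t\ge0}$, $T_tf(k)=\mathbb{E}[f(Y_t)\mid Y_0=k]$. (1) For every bounded $f:\mathbb{N}\to\mathbb{R}_+$, all $0\le q<p<1$ and all $t\ge\log\frac{(1-q)(2-p)}{(1-p)(2-q)}$, $$\|T_tf\|_{L^q(\mathrm{Poi}(\lambda))}\ge\|f\|_{L^p(\mathrm{Poi}(\lambda))}.$$ (2) Let $Y_0$ be distributed according to $\mathrm{Poi}(\lambda)$, let $a,b\ge0$, and let $A,B\subseteq\mathbb{N}$ have $\mathrm{Poi}(\lambda)$-measure $e^{-a^2/2}$ and $e^{-b^2/2}$ respectively. Then for every $t>0$ $$\mathbb{P}\{Y_0\in A,\ Y_t\in B\}\ge\exp\left(-\frac{(2-e^{-t})(a^2+b^2)+2e^{-t/2}ab}{4(1-e^{-t})}\right).$$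
   Context: $\mathbb{N}=\{0,1,2,\dots\}$. The $q/q/\infty$ process is the continuous-time Markov chain on $\mathbb{N}$ (number of customers in a queue with infinitely many servers) which jumps from $k$ to $k+1$ at rate $\lambda$ (Poisson arrivals) and from $k$ to $k-1$ at rate $k$ (independent exponential service times of mean $1$); i.e. $T_t=e^{-tL}$ with $Lf(k)=(k+\lambda)f(k)-kf(k-1)-\lambda f(k+1)$. It is reversible with respect to $\mathrm{Poi}(\lambda)$, the Poisson distribution of mean $\lambda$. For a nonnegative function $f$ and probability measure $\nu$, $\|f\|_{L^p(\nu)}=(\int f^p\,d\nu)^{1/p}$ for $0<p<1$, and $\|f\|_{L^0(\nu)}=\exp(\int\log f\,d\nu)$, with conventions $\log0=-\infty$, $\exp(-\infty)=0$. *)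

(* Defs.v *)
From HB Require Import structures.
From mathcomp Require Import all_boot all_order all_algebra.
From mathcomp Require Import all_classical all_reals all_analysis.

Set Implicit Arguments.
Unset Strict Implicit.
Unset Printing Implicit Defensive.

Import Order.TTheory GRing.Theory Num.Theory.
Import numFieldNormedType.Exports.

Local Open Scope classical_set_scope.
Local Open Scope ring_scope.

(* [poisson_prob] takes an extra natural number that its value does not
   depend on; 0 is a dummy. *)
Definition Poi {R : realType} (lam : R) : probability nat R :=
  poisson_prob lam 0%N.

(* The jump rates of the q/q/infty process: with
     L f k = (k + lam) f k - k f (k - 1) - lam f (k + 1),
   one has - L f k = \sum_j qqinf_rate lam k j * f j. *)
Definition qqinf_rate {R : realType} (lam : R) (i j : nat) : R :=
  if j == i.+1 then lam
  else if i == j.+1 then i%:R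
  else if j == i then - (i%:R + lam)
  else 0.

(* [P t k] is the law of Y_t given Y_0 = k, where Y is the continuous-time
   Markov chain with the above rates. These rates are conservative and
   non-explosive, so they determine [P t] for all t >= 0; the values of [P]
   at negative times are irrelevant. *)
Record qqinf_transition {R : realType} (lam : R)
    (P : R -> nat -> probability nat R) : Prop := {
  qqinf_start : forall (k : nat) (A : set nat),
    P 0 k A = \d_k A ;
  qqinf_chapman_kolmogorov : forall (s t : R) (k : nat) (A : set nat),
    0 <= s -> 0 <= t ->
    P (s + t) k A = (\int[P s k]_j P t j A)%E ;
  qqinf_rates : forall i j : nat,
    (fine (P h i [set j]) - (j == i)%:R) / h @[h --> 0^'+]
      --> qqinf_rate lam i j
}.

(* T_t f(k) = E[f(Y_t) | Y_0 = k] *)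
Definition semigroup {R : realType} (P : R -> nat -> probability nat R)
    (t : R) (f : nat -> R) (k : nat) : R :=
  \int[P t k]_j f j.

(* The Markov property: for 0 <= s_0 <= ... <= s_(n+1), given
   Y_(s_0) = x_0, ..., Y_(s_n) = x_n, the variable Y_(s_(n+1)) has law
   P (s_(n+1) - s_n) x_n. *)
Definition markov_chain {R : realType} (P : R -> nat -> probability nat R)
    (d : measure_display) (Omega : measurableType d) (Pr : probability Omega R)
    (Y : R -> {RV Pr >-> nat}) : Prop :=
  forall (n : nat) (s : nat -> R) (x : nat -> nat),
    0 <= s 0%N -> (forall m : nat, (m <= n)%N -> s m <= s m.+1) ->
    Pr (\bigcap_(m in `I_n.+2) (Y (s m) @^-1` [set x m])) =
    (Pr (\bigcap_(m in `I_n.+1) (Y (s m) @^-1` [set x m])) *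
     P (s n.+1 - s n)%R (x n) [set x n.+1])%E.

(* [lne 0 = -oo] and [expeR -oo = 0]; the library's [Lnorm] at exponent 0 is
   not the geometric mean. *)
Definition Lp {R : realType} (nu : probability nat R) (p : R) (f : nat -> R) :
    \bar R :=
  (if p == 0%R then expeR (\int[nu]_k lne (f k)%:E)
   else 'N[nu]_(p%:E)[EFin \o f])%E.

(* Main.v *)
Require Import Defs.
From HB Require Import structures.
From mathcomp Require Import all_boot all_order all_algebra.
From mathcomp Require Import all_classical all_reals all_analysis.
From mathcomp Require Import ring lra zify.

Set Implicit Arguments.
Unset Strict Implicit.
Unset Printing Implicit Defensive.

Import Order.TTheory GRing.Theory Num.Theory.
Import numFieldNormedType.Exports.

Local Open Scope classical_set_scope.
Local Open Scope ring_scope.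

(** Put x = exp (- t). The queue is a limit of [n] independent sites, each
    occupied with probability lam / n and each refreshed independently with
    probability 1 - x; the number of occupied sites replaces Y.

    One site. The claim is that the q-norm of x g + (1 - x) E g is at least the
    p-norm of g when x <= (1 - p) (2 - q) / ((1 - q) (2 - p)). The operator
    preserves the mean, so the mean may be taken to be 1, and then it suffices
    to average the pointwise inequality [power_gap_contraction], which compares
    X - 1 - (X ^ p - 1) / p at X with its analogue for q at 1 + x (X - 1). Both
    sides have a double zero at X = 1, and their second derivatives compare by
    concavity of the logarithm. Together with the reverse Hoelder inequality
    this gives a two-function inequality [two_point_two_function].

    Many sites. The two-function form passes from sites to sums of sites by
    applying it to one site at a time ([correlated_mean_lower_bound]), and it
    survives the limit n -> oo ([expectation_limit], [correlated_mean_limit]).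
    The limit kernel sends k to Bin(k, x) + Poi(lam (1 - x)).

    The queue. The limit kernel is the transition function of the queue
    ([transition_mehler]): both solve the backward equation, whose bounded
    solutions are unique by a maximum principle with Lyapunov function k + 1
    ([maximum_principle]). Symmetry of the site model gives reversibility.

    Endgame. Choosing f = (T g) ^ (q - 1) in the two-function inequality gives
    the first part for functions bounded away from 0; adding a constant e to f
    and letting e -> 0 removes that restriction, and letting q -> 0 gives the
    geometric mean ([log_hypercontractive], [geometric_mean_ge]). For the second
    part, write t = t1 + t2 and move T_t2 onto the indicator of A by
    reversibility; each factor is bounded below by its geometric mean, which
    separates the product (Jensen), and the first part with q = 0 bounds the two
    factors. The exponents, hence t1 and t2, are then optimised
    ([optimal_exponents]). *)

(** * A scalar inequality between powers *)

Lemma ln_concave (R : realType) (s u v : R) : 0 <= s <= 1 -> 0 < u -> 0 < v ->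
  s * ln u + (1 - s) * ln v <= ln (s * u + (1 - s) * v).
Proof.
move=> /andP[s0 s1] u0 v0.
by have := concave_ln (Itv01 s0 s1) u0 v0; rewrite !convRE.
Qed.

Lemma weighted_AMGM (R : realType) (s u v : R) :
  0 <= s <= 1 -> 0 < u -> 0 < v ->
  u `^ s * v `^ (1 - s) <= s * u + (1 - s) * v.
Proof.
move=> s01 u0 v0; have /andP[s0 s1] := s01.
have m0 : 0 < s * u + (1 - s) * v.
  have [->|sN0] := eqVneq s 0; first by lra.
  by rewrite ltr_pwDl ?mulr_gt0// ?mulr_ge0 ?subr_ge0 ?(ltW v0)// lt0r sN0.
rewrite /powR !gt_eqF// -expRD -[leRHS]lnK// ler_expR.
exact: ln_concave.
Qed.

Lemma ge0_of_second_derivative (R : realType) (f f' f'' : R -> R) :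
  (forall x : R, 0 < x -> is_derive x 1 f (f' x)) ->
  (forall x : R, 0 < x -> is_derive x 1 f' (f'' x)) ->
  f 1 = 0 -> f' 1 = 0 -> (forall x, 0 < x -> 0 <= f'' x) ->
  forall x, 0 < x -> 0 <= f x.
Proof.
move=> df df' f1 f'1 f''0.
have mvt (g dg : R -> R) a b : (forall x : R, 0 < x -> is_derive x 1 g (dg x)) ->
    0 < a -> a <= b -> exists2 c, a <= c <= b & g b - g a = dg c * (b - a).
  move=> dgP a0 ab.
  have [||c] := @MVT_segment R g dg a b ab.
  - move=> y /[!in_itv]/= /andP[ay _]; exact/dgP/(lt_trans a0).
  - apply: continuous_in_subspaceT => y; rewrite inE/= in_itv/= => /andP[ay _].
    have y0 := lt_le_trans a0 ay; have ? := dgP _ y0.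
    by apply/differentiable_continuous/derivable1_diffP/ex_derive.
  by rewrite in_itv/= => cab E; exists c.
move=> x x0; have [x1|/ltW x1] := leP x 1.
  have [c /andP[xc c1]] := mvt _ _ _ _ df x0 x1.
  have [d /andP[cd _]] := mvt _ _ _ _ df' (lt_le_trans x0 xc) c1.
  rewrite f1 f'1 !sub0r => Ed E.
  have d0 := lt_le_trans (lt_le_trans x0 xc) cd.
  by rewrite -oppr_le0 E -[f' c]opprK Ed mulNr oppr_le0 !mulr_ge0 ?subr_ge0// f''0.
have [c /andP[c1 cx]] := mvt _ _ _ _ df ltr01 x1.
have [d /andP[d1 _]] := mvt _ _ _ _ df' ltr01 c1.
rewrite f1 f'1 !subr0 => Ed ->.
by rewrite Ed !mulr_ge0 ?subr_ge0// f''0// (lt_le_trans ltr01).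
Qed.

(** The left-hand side vanishes at b = a. Bounding both logarithms in its
    derivative in b by their tangents leaves at least (1 - b) b / (1 + b). *)
Lemma log_gap_ge0 (R : realType) (a b : R) : 0 < a -> a <= b -> b <= 1 ->
  0 <= (a + b) * (ln (1 + b) - ln (1 + a)) + a * ln a - b * ln b.
Proof.
move=> a0 ab b1.
pose N c := (a + c) * (ln (1 + c) - ln (1 + a)) + a * ln a - c * ln c.
pose dN c := (ln (1 + c) - ln (1 + a)) + (a + c) / (1 + c) - (ln c + 1).
have dNP (x : R) : 0 < x -> is_derive x 1 N (dN x).
  move=> x0; have ? := is_derive1_ln x0.
  have x10 : 0 < 1 + x by rewrite addr_gt0.
  have dl : is_derive x 1 (fun c : R => ln (1 + c)) (1 + x)^-1.
    have d1 : is_derive x 1 (fun c : R => 1 + c) (0 + 1) by exact: is_deriveD.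
    rewrite -[X in is_derive _ _ _ X]mulr1 -[X in _ * X]add0r.
    apply: (@is_derive1_comp R (@ln R) (fun c => 1 + c)).
    exact: is_derive1_ln.
  rewrite /N; apply: is_derive_eq; rewrite /dN /=.
  rewrite -![_ *: _]/(_ * _).
  have xN0 : x != 0 by rewrite gt_eqF.
  have x1N0 : 1 + x != 0 by rewrite gt_eqF.
  by field; rewrite xN0 x1N0.
have N0 : N a = 0 by rewrite /N subrr mulr0 add0r subrr.
have [||c] := @MVT_segment R N dN a b ab.
- by move=> y /[!in_itv]/= /andP[ay _]; exact/dNP/(lt_trans a0).
- apply: continuous_in_subspaceT => y; rewrite inE/= in_itv/= => /andP[ay _].
  have y0 := lt_le_trans a0 ay; have ? := dNP _ y0.
  by apply/differentiable_continuous/derivable1_diffP/ex_derive.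
rewrite N0 subr0 in_itv/= => /andP[ac cb] E.
suff dN0 : 0 <= dN c by rewrite [leRHS]E mulr_ge0// subr_ge0.
have c0 := lt_le_trans a0 ac.
have c10 : 0 < 1 + c by rewrite addr_gt0.
have a10 : 0 < 1 + a by rewrite addr_gt0.
have h1 : ln c <= c - 1.
  by have := @le_ln1Dx R (c - 1); rewrite subrKC; apply; lra.
have h2 : ln (1 + a) - ln (1 + c) <= (1 + a) / (1 + c) - 1.
  rewrite -ln_div ?posrE//.
  have := @le_ln1Dx R ((1 + a) / (1 + c) - 1).
  rewrite subrKC; apply.
  by rewrite ltrBDr addrC subrr divr_gt0.
have : 0 <= (1 - c) * c / (1 + c).
  by rewrite divr_ge0 ?mulr_ge0 ?(ltW c10) ?(ltW c0)// subr_ge0 (le_trans cb).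
rewrite /dN.
have -> : (1 - c) * c / (1 + c) =
   (1 - ((1 + a) / (1 + c))) + (a + c)/ (1 + c) - c.
  by field; rewrite gt_eqF.
lra.
Qed.

(** The logarithm of x ^ 2 (1 - q) Y ^ (q - 2) <= (1 - p) X ^ (p - 2), where
    Y = x X + (1 - x). Splitting Y with the weights th = (2 - p) / (2 - q) and
    1 - th, concavity of the logarithm removes X. What remains is monotone in x,
    and at the largest x it is [log_gap_ge0] for 1 - p and 1 - q. *)
Lemma ln_second_derivative_comparison (R : realType) (p q x X : R) :
  0 < q -> q < p -> p < 1 -> 0 < x ->
  x <= (1 - p) * (2 - q) / ((1 - q) * (2 - p)) -> 0 < X ->
  2 * ln x + ln (1 - q) + (q - 2) * ln (x * X + (1 - x)) <=
  ln (1 - p) + (p - 2) * ln X.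
Proof.
move=> q0 qp p1 x0; set x1 := (X in _ <= X) => xx1 X0.
have x1P : 1 - x1 = (p - q) / ((1 - q) * (2 - p)).
  by rewrite /x1; field; rewrite !gt_eqF//; lra.
have a0 : 0 < 1 - p by lra.
have b0 : 0 < 1 - q by lra.
have a1 : 0 < 2 - p by lra.
have b1 : 0 < 2 - q by lra.
have pq : 0 < p - q by lra.
have x1gt0 : 0 < 1 - x1 by rewrite x1P divr_gt0 ?mulr_gt0.
have x0' : 0 < 1 - x by lra.
pose th := (2 - p) / (2 - q).
have th0 : 0 < th by rewrite divr_gt0.
have th1 : 1 - th = (p - q) / (2 - q) by rewrite /th; field; rewrite gt_eqF.
have th10 : 0 < 1 - th by rewrite th1 divr_gt0.
have th01 : 0 <= th <= 1 by apply/andP; split; lra.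
have := @ln_concave R th (x * X / th) ((1 - x) / (1 - th)) th01.
rewrite !divr_gt0 ?mulr_gt0// => /(_ isT isT).
have -> : th * (x * X / th) + (1 - th) * ((1 - x) / (1 - th)) =
    x * X + (1 - x) by field; rewrite !gt_eqF.
rewrite !ln_div ?lnM ?posrE ?mulr_gt0 ?invr_gt0// th1 /th ln_div ?posrE//.
set Y := x * X + (1 - x) => hY.
have {}hY : (2 - p) * (ln x + ln X - (ln (2 - p) - ln (2 - q))) +
    (p - q) * (ln (1 - x) - (ln (p - q) - ln (2 - q))) <= (2 - q) * ln Y.
  rewrite -(ler_pM2l b1) in hY; apply: le_trans hY.
  by rewrite le_eqVlt; apply/orP; left; apply/eqP; field; rewrite gt_eqF.
have h1 : p * ln x <=
    p * (ln (1 - p) + ln (2 - q) - (ln (1 - q) + ln (2 - p))).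
  rewrite ler_pM2l ?(lt_trans q0)// -!lnM ?posrE// -ln_div ?posrE ?mulr_gt0//.
  by rewrite ler_ln ?posrE// divr_gt0 ?mulr_gt0.
have h2 : (p - q) * (ln (p - q) - (ln (1 - q) + ln (2 - p))) <=
    (p - q) * ln (1 - x).
  rewrite ler_pM2l// -!lnM ?posrE// -ln_div ?posrE ?mulr_gt0//.
  by rewrite ler_ln ?posrE -?x1P//; lra.
have := @log_gap_ge0 R (1 - p) (1 - q) a0.
have -> : 1 + (1 - q) = 2 - q by ring.
have -> : 1 + (1 - p) = 2 - p by ring.
have -> : 1 - p <= 1 - q by lra.
have -> : 1 - q <= 1 by lra.
move=> /(_ isT isT).
move: hY h1 h2.
move: (ln x) (ln X) (ln Y) (ln (2 - p)) (ln (2 - q)) (ln (1 - x)) (ln (p - q))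
  (ln (1 - p)) (ln (1 - q)) => *.
lra.
Qed.

(** The gap between X - 1 and the concave function (X ^ p - 1) / p, to which it
    is tangent at 1. *)
Definition power_gap {R : realType} (p X : R) : R := X - 1 - (X `^ p - 1) / p.

Lemma is_derive_affine_powR (R : realType) (a x c X : R) : 0 < x * X + c ->
  is_derive X 1 (fun X : R => (x * X + c) `^ a)
    (a * (x * X + c) `^ (a - 1) * x).
Proof.
move=> Y0.
have d1 : is_derive X 1 (fun X : R => x * X + c) x.
  by apply: is_derive_eq; rewrite -![_ *: _]/(_ * _) addr0 mulr1.
apply: (@is_derive1_comp R (fun Y => Y `^ a) (fun X => x * X + c)).
exact: is_derive1_powR.
Qed.

(** Both sides vanish to first order at X = 1, so it is enough to compare second
    derivatives. *)
Lemma power_gap_contraction (R : realType) (p q x X : R) :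
  0 < q -> q < p -> p < 1 -> 0 < x ->
  x <= (1 - p) * (2 - q) / ((1 - q) * (2 - p)) -> 0 < X ->
  power_gap q (x * X + (1 - x)) <= power_gap p X.
Proof.
move=> q0 qp p1 x0 xx1 X0; rewrite -subr_ge0.
have x1 : x < 1.
  apply: (le_lt_trans xx1); rewrite ltr_pdivrMr ?mulr_gt0//; last by lra.
  - by nra.
  - by lra.
have Ypos (Z : R) : 0 < Z -> 0 < x * Z + (1 - x).
  by move=> Z0; rewrite addr_gt0 ?mulr_gt0// subr_gt0.
have p0 := lt_trans q0 qp.
pose f' Z := (1 - Z `^ (p - 1)) - x * (1 - (x * Z + (1 - x)) `^ (q - 1)).
pose f'' Z := (1 - p) * Z `^ (p - 2) -
  x ^+ 2 * (1 - q) * (x * Z + (1 - x)) `^ (q - 2).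
have pN : p != 0 by rewrite gt_eqF.
have qN : q != 0 by rewrite gt_eqF.
apply: (@ge0_of_second_derivative R
  (fun Z => power_gap p Z - power_gap q (x * Z + (1 - x))) f' f'').
- move=> Z Z0; have d1 := is_derive1_powR p Z0.
  have d2 := is_derive_affine_powR q (Ypos _ Z0).
  have d3 : is_derive Z 1 (fun X : R => x * X + (1 - x)) x.
    by apply: is_derive_eq; rewrite -![_ *: _]/(_ * _) addr0 mulr1.
  rewrite /power_gap; apply: is_derive_eq; rewrite -![_ *: _]/(_ * _) /f'.
  by field; rewrite pN qN.
- move=> Z Z0; have d1 := is_derive1_powR (p - 1) Z0.
  have d2 := is_derive_affine_powR (q - 1) (Ypos _ Z0).
  rewrite /f'; apply: is_derive_eq; rewrite -![_ *: _]/(_ * _) /f''.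
  have -> : p - 1 - 1 = p - 2 by ring.
  have -> : q - 1 - 1 = q - 2 by ring.
  by ring.
- by rewrite /power_gap mulr1 subrKC powR1 subrr !mul0r !subrr.
- by rewrite /f' mulr1 subrKC !powR1 subrr mulr0 subrr.
- move=> Z Z0; rewrite subr_ge0.
  have b0 : 0 < 1 - q by lra.
  have a0 : 0 < 1 - p by lra.
  have := @ln_second_derivative_comparison R p q x Z q0 qp p1 x0 xx1 Z0.
  rewrite -ler_expR !expRD expRM_natl !lnK ?posrE//.
  by rewrite /powR !gt_eqF ?Ypos.
- exact: X0.
Qed.

(** * The two-point space *)

(** The Hoelder conjugate q / (q - 1), negative for 0 < q < 1. *)
Definition dual_exponent {R : realType} (q : R) : R := - q / (1 - q).

(** Divide g by its mean m and average [power_gap_contraction]: the linear terms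
    cancel, leaving (1 - psiq) / q <= (1 - psip) / p for the averaged powers
    psip and psiq. By the weighted AM-GM inequality this implies
    psip ^ (q / p) <= psiq. *)
Lemma two_point_norm (R : realType) (al p q x g1 g0 : R) :
  0 <= al <= 1 -> 0 < q -> q < p -> p < 1 -> 0 < x ->
  x <= (1 - p) * (2 - q) / ((1 - q) * (2 - p)) -> 0 < g1 -> 0 < g0 ->
  (al * g1 `^ p + (1 - al) * g0 `^ p) `^ p^-1 <=
  (al * (x * g1 + (1 - x) * (al * g1 + (1 - al) * g0)) `^ q +
   (1 - al) * (x * g0 + (1 - x) * (al * g1 + (1 - al) * g0)) `^ q) `^ q^-1.
Proof.
move=> al01 q0 qp p1 x0 xx1 g10 g00; set m := al * g1 + (1 - al) * g0.
have /andP[al0 al1] := al01.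
have p0 := lt_trans q0 qp.
have avg0 u v : 0 < u -> 0 < v -> 0 < al * u + (1 - al) * v.
  move=> u0 v0; have [->|aN] := eqVneq al 0; first lra.
  by rewrite ltr_pwDl ?mulr_gt0// ?mulr_ge0 ?subr_ge0 ?(ltW v0)// lt0r aN.
have m0 : 0 < m by exact: avg0.
have x1 : x < 1.
  by apply: (le_lt_trans xx1); rewrite ltr_pdivrMr ?mulr_gt0//; nra.
pose X1 := g1 / m; pose X0 := g0 / m.
have X10 : 0 < X1 by rewrite divr_gt0.
have X00 : 0 < X0 by rewrite divr_gt0.
have g1E : m * X1 = g1 by rewrite /X1 mulrCA divff ?mulr1// gt_eqF.
have g0E : m * X0 = g0 by rewrite /X0 mulrCA divff ?mulr1// gt_eqF.
have mX : al * X1 + (1 - al) * X0 = 1.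
  by rewrite /X1 /X0 !mulrA -mulrDl divff// gt_eqF.
clearbody X1 X0 m.
pose Y1 := x * X1 + (1 - x); pose Y0 := x * X0 + (1 - x).
have [Y1E Y0E] : Y1 = x * X1 + (1 - x) /\ Y0 = x * X0 + (1 - x) by [].
clearbody Y1 Y0.
have Y10 : 0 < Y1 by have := mulr_gt0 x0 X10; rewrite Y1E; lra.
have Y00 : 0 < Y0 by have := mulr_gt0 x0 X00; rewrite Y0E; lra.
have T1E : x * g1 + (1 - x) * m = m * Y1 by rewrite -g1E Y1E; ring.
have T0E : x * g0 + (1 - x) * m = m * Y0 by rewrite -g0E Y0E; ring.
rewrite T1E T0E -g1E -g0E.
rewrite (powRM p (ltW m0) (ltW X10)) (powRM p (ltW m0) (ltW X00)).
rewrite (powRM q (ltW m0) (ltW Y10)) (powRM q (ltW m0) (ltW Y00)).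
pose psip := al * X1 `^ p + (1 - al) * X0 `^ p.
pose psiq := al * Y1 `^ q + (1 - al) * Y0 `^ q.
have -> : al * (m `^ p * X1 `^ p) + (1 - al) * (m `^ p * X0 `^ p) =
  m `^ p * psip by rewrite /psip; ring.
have -> : al * (m `^ q * Y1 `^ q) + (1 - al) * (m `^ q * Y0 `^ q) =
  m `^ q * psiq by rewrite /psiq; ring.
have [psipE psiqE] : psip = al * X1 `^ p + (1 - al) * X0 `^ p /\
  psiq = al * Y1 `^ q + (1 - al) * Y0 `^ q by [].
have psip0 : 0 < psip by apply: avg0; exact: powR_gt0.
have psiq0 : 0 < psiq by apply: avg0; exact: powR_gt0.
clearbody psip psiq.
rewrite (powRM _ (powR_ge0 _ _) (ltW psip0)) (powRM _ (powR_ge0 _ _) (ltW psiq0)).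
rewrite -!powRrM !mulfV ?gt_eqF//.
rewrite ler_pM2l ?powR_gt0//.
suff h : psip `^ (q / p) <= psiq.
  have -> : p^-1 = (q / p) * q^-1 by rewrite mulrAC divff ?mul1r// gt_eqF.
  by rewrite powRrM; apply: ge0_ler_powR;
    rewrite ?invr_ge0 ?nnegrE ?powR_ge0 ?(ltW q0) ?(ltW psiq0).
have qp01 : 0 <= q / p <= 1.
  by rewrite divr_ge0 ?(ltW q0) ?(ltW p0)//= ler_pdivrMr// mul1r ltW.
have := weighted_AMGM qp01 psip0 ltr01.
rewrite powR1 !mulr1 => /le_trans; apply.
have := power_gap_contraction q0 qp p1 x0 xx1 X10; rewrite -Y1E => h1.
have := power_gap_contraction q0 qp p1 x0 xx1 X00; rewrite -Y0E => h0.
have : al * power_gap q Y1 + (1 - al) * power_gap q Y0 <=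
    al * power_gap p X1 + (1 - al) * power_gap p X0.
  by rewrite lerD ?ler_wpM2l ?subr_ge0.
have -> : al * power_gap p X1 + (1 - al) * power_gap p X0 = - (psip - 1) / p.
  transitivity (al * X1 + (1 - al) * X0 - 1 - (psip - 1) / p).
    by rewrite /power_gap psipE; ring.
  by rewrite mX; ring.
have -> : al * power_gap q Y1 + (1 - al) * power_gap q Y0 = - (psiq - 1) / q.
  transitivity (x * (al * X1 + (1 - al) * X0 - 1) - (psiq - 1) / q).
    by rewrite /power_gap psiqE Y1E Y0E; ring.
  by rewrite mX; ring.
rewrite ler_pdivrMr// => h.
have : q / p * psip + (1 - q / p) = 1 - (- (psip - 1) / p * q) by ring.
move=> ->; lra.
Qed.

(** The weighted AM-GM inequality for u v and the dual power of u, with weights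
    q and 1 - q: the exponent of u in the geometric mean is 0. *)
Lemma reverse_Young (R : realType) (q u v : R) : 0 < q -> q < 1 ->
  0 < u -> 0 < v -> v `^ q <= q * (u * v) + (1 - q) * u `^ dual_exponent q.
Proof.
move=> q0 q1 u0 v0.
have q01 : 0 <= q <= 1 by rewrite !ltW.
have := @weighted_AMGM R q (u * v) (u `^ dual_exponent q) q01.
rewrite mulr_gt0 ?powR_gt0// => /(_ isT isT).
rewrite -powRrM /dual_exponent mulfVK ?subr_eq0 ?gt_eqF// powRM ?(ltW u0) ?(ltW v0)//.
by rewrite powRN mulrAC divff ?mul1r// gt_eqF ?powR_gt0.
Qed.

Lemma two_point_reverse_Holder (R : realType) (al q f1 f0 h1 h0 : R) :
  0 <= al <= 1 -> 0 < q -> q < 1 -> 0 < f1 -> 0 < f0 -> 0 < h1 -> 0 < h0 ->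
  (al * f1 `^ dual_exponent q + (1 - al) * f0 `^ dual_exponent q)
    `^ (dual_exponent q)^-1 *
  (al * h1 `^ q + (1 - al) * h0 `^ q) `^ q^-1 <=
  al * (f1 * h1) + (1 - al) * (f0 * h0).
Proof.
move=> al01 q0 q1 f10 f00 h10 h00; set r := dual_exponent q.
have /andP[al0 al1] := al01.
have avg0 u v : 0 < u -> 0 < v -> 0 < al * u + (1 - al) * v.
  move=> u0 v0; have [->|aN] := eqVneq al 0; first lra.
  by rewrite ltr_pwDl ?mulr_gt0// ?mulr_ge0 ?subr_ge0 ?(ltW v0)// lt0r aN.
have rN : r != 0.
  by rewrite /r /dual_exponent mulf_neq0 ?oppr_eq0 ?invr_eq0
     ?subr_eq0 ?gt_eqF// ?(gt_eqF q1).
set F := al * f1 `^ r + _; set H := al * h1 `^ q + _.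
have F0 : 0 < F by apply: avg0; exact: powR_gt0.
have H0 : 0 < H by apply: avg0; exact: powR_gt0.
set a := F `^ _; set b := H `^ _; set S := al * (f1 * h1) + _.
have a0 : 0 < a by exact: powR_gt0.
have b0 : 0 < b by exact: powR_gt0.
have aF : a `^ r = F by rewrite /a -powRrM mulVf// powRr1// ltW.
have bH : b `^ q = H by rewrite /b -powRrM mulVf ?gt_eqF// powRr1// ltW.
have FE : F = al * f1 `^ r + (1 - al) * f0 `^ r by [].
have HE : H = al * h1 `^ q + (1 - al) * h0 `^ q by [].
have SE : S = al * (f1 * h1) + (1 - al) * (f0 * h0) by [].
clearbody a b F H S.
have key f h : 0 < f -> 0 < h ->
    h `^ q / H <= q * (f * h / (a * b)) + (1 - q) * (f `^ r / F).
  move=> fP hP; have := @reverse_Young R q (f / a) (h / b) q0 q1.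
  rewrite !divr_gt0// => /(_ isT isT).
  have a'0 : 0 <= a^-1 by rewrite invr_ge0 ltW.
  have b'0 : 0 <= b^-1 by rewrite invr_ge0 ltW.
  rewrite (powRM _ (ltW fP) a'0) (powRM _ (ltW hP) b'0) -/r.
  have inv c s : 0 < c -> c^-1 `^ s = (c `^ s)^-1.
    by move=> c0; rewrite /powR !gt_eqF ?invr_gt0// lnV ?posrE// mulrN expRN.
  by rewrite !inv// aF bH mulrACA -invfM.
have : al * (h1 `^ q / H) + (1 - al) * (h0 `^ q / H) <=
    al * (q * (f1 * h1 / (a * b)) + (1 - q) * (f1 `^ r / F)) +
    (1 - al) * (q * (f0 * h0 / (a * b)) + (1 - q) * (f0 `^ r / F)).
  by rewrite lerD ?ler_wpM2l ?subr_ge0 ?key.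
have -> : al * (h1 `^ q / H) + (1 - al) * (h0 `^ q / H) = 1.
  by rewrite !mulrA -mulrDl -HE divff// gt_eqF.
have -> : al * (q * (f1 * h1 / (a * b)) + (1 - q) * (f1 `^ r / F)) +
    (1 - al) * (q * (f0 * h0 / (a * b)) + (1 - q) * (f0 `^ r / F)) =
    q * (S / (a * b)) + (1 - q) * (F / F).
  by rewrite SE {3}FE; ring.
rewrite divff ?gt_eqF// mulr1 => h.
have : q * 1 <= q * (S / (a * b)) by lra.
by rewrite ler_pM2l// ler_pdivlMr ?mulr_gt0// mul1r.
Qed.

(** The inequality of norms for x I + (1 - x) E, tested against f. In this form,
    unlike that of [two_point_norm], it can be iterated over the coordinates of
    a product without a reverse Minkowski inequality. *)
Lemma two_point_two_function (R : realType) (al p q x f1 f0 g1 g0 : R) :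
  0 <= al <= 1 -> 0 < q -> q < p -> p < 1 -> 0 < x ->
  x <= (1 - p) * (2 - q) / ((1 - q) * (2 - p)) ->
  0 < f1 -> 0 < f0 -> 0 < g1 -> 0 < g0 ->
  (al * f1 `^ dual_exponent q + (1 - al) * f0 `^ dual_exponent q)
    `^ (dual_exponent q)^-1 *
  (al * g1 `^ p + (1 - al) * g0 `^ p) `^ p^-1 <=
  al * (f1 * ((x + (1 - x) * al) * g1 + (1 - (x + (1 - x) * al)) * g0)) +
  (1 - al) * (f0 * ((1 - x) * al * g1 + (1 - (1 - x) * al) * g0)).
Proof.
move=> al01 q0 qp p1 x0 xx1 f10 f00 g10 g00.
set be := x + _; set ga := (1 - x) * al.
have /andP[al0 al1] := al01.
have q1 := lt_trans qp p1.
have x1 : x < 1.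
  by apply: (le_lt_trans xx1); rewrite ltr_pdivrMr ?mulr_gt0//; nra.
have T1 : x * g1 + (1 - x) * (al * g1 + (1 - al) * g0) = be * g1 + (1 - be) * g0.
  by rewrite /be; ring.
have T0 : x * g0 + (1 - x) * (al * g1 + (1 - al) * g0) = ga * g1 + (1 - ga) * g0.
  by rewrite /ga; ring.
have m0 : 0 <= (1 - x) * (al * g1 + (1 - al) * g0).
  rewrite mulr_ge0 ?subr_ge0 ?(ltW x1)// addr_ge0//.
    by rewrite mulr_ge0// ltW.
  by rewrite mulr_ge0 ?subr_ge0// ltW.
have T10 : 0 < be * g1 + (1 - be) * g0 by rewrite -T1 ltr_pwDl ?mulr_gt0.
have T00 : 0 < ga * g1 + (1 - ga) * g0 by rewrite -T0 ltr_pwDl ?mulr_gt0.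
apply: le_trans (two_point_reverse_Holder al01 q0 q1 f10 f00 T10 T00).
apply: ler_wpM2l; first exact: powR_ge0.
have := two_point_norm al01 q0 qp p1 x0 xx1 g10 g00.
by rewrite T1 T0.
Qed.

(** * Sums of independent sites *)

(** The mean of h under Bin(m, c), in the recursive form that conditions on one
    of the sites. *)
Fixpoint binomial_mean {R : realType} (c : R) (m : nat) (h : nat -> R) : R :=
  if m is m'.+1 then
    c * binomial_mean c m' (fun j => h j.+1) + (1 - c) * binomial_mean c m' h
  else h 0%N.

(** The mean of h under the convolution of Bin(k, b) and Bin(m, c). *)
Fixpoint two_binomial_mean {R : realType} (b c : R) (k m : nat)
    (h : nat -> R) : R :=
  if k is k'.+1 then
    b * two_binomial_mean b c k' m (fun j => h j.+1) +
    (1 - b) * two_binomial_mean b c k' m h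
  else binomial_mean c m h.

Definition averaging {R : realType} (Phi : (nat -> R) -> R) : Prop :=
  [/\ forall h h', Phi (fun j => h j + h' j) = Phi h + Phi h',
      forall a h, Phi (fun j => a * h j) = a * Phi h,
      forall h h', (forall j, h j <= h' j) -> Phi h <= Phi h' &
      Phi (fun=> 1) = 1].

Lemma averaging_step (R : realType) (c : R) (Phi : (nat -> R) -> R) :
  0 <= c <= 1 -> averaging Phi ->
  averaging (fun h => c * Phi (fun j => h j.+1) + (1 - c) * Phi h).
Proof.
move=> /andP[c0 c1] [PhiD PhiZ Phi_le Phi1]; split.
- by move=> h h'; rewrite !PhiD; ring.
- by move=> a h; rewrite !PhiZ; ring.
- by move=> h h' hh'; rewrite lerD ?ler_wpM2l ?subr_ge0// Phi_le.
- by rewrite !Phi1; ring.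
Qed.

Lemma averaging_binomial_mean (R : realType) (c : R) (m : nat) : 0 <= c <= 1 ->
  averaging (binomial_mean c m).
Proof.
by move=> c01; elim: m => [|m IHm] //=; exact: averaging_step.
Qed.

Lemma averaging_two_binomial_mean (R : realType) (b c : R) (k m : nat) :
  0 <= b <= 1 -> 0 <= c <= 1 -> averaging (two_binomial_mean b c k m).
Proof.
move=> b01 c01; elim: k => [|k IHk]; first exact: averaging_binomial_mean.
exact: averaging_step.
Qed.

Lemma binomial_mean_gt0 (R : realType) (c : R) (m : nat) (h : nat -> R) :
  0 <= c <= 1 -> (forall j, 0 < h j) -> 0 < binomial_mean c m h.
Proof.
move=> /andP[c0 c1]; elim: m h => [|m IHm] h h0 //=.
have := IHm _ h0; have := IHm _ (fun j => h0 j.+1).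
set u := binomial_mean _ _ _; set v := binomial_mean _ _ _ => u0 v0.
have [->|cN] := eqVneq c 0; first lra.
by rewrite ltr_pwDl ?mulr_gt0// ?mulr_ge0 ?subr_ge0 ?(ltW v0)// lt0r cN.
Qed.

Lemma eq_binomial_mean (R : realType) (c : R) (m : nat) (h h' : nat -> R) :
  (forall j, (j <= m)%N -> h j = h' j) -> binomial_mean c m h = binomial_mean c m h'.
Proof.
elim: m h h' => [|m IHm] h h' hh' /=; first exact: hh'.
congr (_ * _ + _ * _); apply: IHm => j jm; apply: hh' => //.
exact: leqW.
Qed.

Lemma two_binomial_mean_succ (R : realType) (b c : R) (k m : nat) (h : nat -> R) :
  two_binomial_mean b c k m.+1 h =
  c * two_binomial_mean b c k m (fun j => h j.+1) + (1 - c) * two_binomial_mean b c k m h.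
Proof. by elim: k h => [|k IHk] h //=; rewrite !IHk; ring. Qed.

(** The mean of f(S) g(S'), where S counts the occupied ones among n sites of
    parameter al and S' counts them after every site has been refreshed with
    probability 1 - x: an occupied site is then still occupied with probability
    x + (1 - x) al, an empty one has become so with probability (1 - x) al. *)
Definition correlated_mean {R : realType} (al x : R) (n : nat) (f g : nat -> R) : R :=
  binomial_mean al n
    (fun k => f k * two_binomial_mean (x + (1 - x) * al) ((1 - x) * al) k (n - k) g).

Lemma correlated_mean_succ (R : realType) (al x : R) (n : nat) (f g : nat -> R) :
  0 <= al <= 1 ->
  correlated_mean al x n.+1 f g =
  al * ((x + (1 - x) * al) *
          correlated_mean al x n (fun k => f k.+1) (fun k => g k.+1) +
        (1 - (x + (1 - x) * al)) * correlated_mean al x n (fun k => f k.+1) g) +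
  (1 - al) * ((1 - x) * al * correlated_mean al x n f (fun k => g k.+1) +
        (1 - (1 - x) * al) * correlated_mean al x n f g).
Proof.
move=> al01; rewrite /correlated_mean; set be := x + _; set ga := (1 - x) * al.
have [binD binZ _ _] := averaging_binomial_mean n al01.
rewrite -!binZ -!binD /=; congr (_ * _ + _ * _); apply: eq_binomial_mean => k kn.
  by rewrite subSS; ring.
by rewrite subSn// two_binomial_mean_succ; ring.
Qed.

(** Under S and S' a given site is occupied first and empty afterwards with the
    same probability al (1 - al) (1 - x) as the other way round. *)
Lemma correlated_mean_sym (R : realType) (al x : R) (n : nat) (f g : nat -> R) :
  0 <= al <= 1 -> correlated_mean al x n f g = correlated_mean al x n g f.
Proof.
move=> al01; elim: n f g => [|n IHn] f g.
  by rewrite /correlated_mean /= mulrC.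
rewrite !correlated_mean_succ// (IHn (fun k => g k.+1)) (IHn g f).
rewrite (IHn (fun k => g k.+1) f) (IHn g (fun k => f k.+1)); ring.
Qed.

(** Condition on the state of one site before and after. The induction
    hypothesis bounds the four conditional means by products of norms, and the
    two-point inequality applied to these norms reassembles them. *)
Lemma correlated_mean_lower_bound (R : realType) (al p q x : R) (n : nat)
    (f g : nat -> R) :
  0 <= al <= 1 -> 0 < q -> q < p -> p < 1 -> 0 < x ->
  x <= (1 - p) * (2 - q) / ((1 - q) * (2 - p)) ->
  (forall k, 0 < f k) -> (forall k, 0 < g k) ->
  (binomial_mean al n (fun k => f k `^ dual_exponent q)) `^ (dual_exponent q)^-1 *
  (binomial_mean al n (fun k => g k `^ p)) `^ p^-1 <= correlated_mean al x n f g.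
Proof.
move=> al01 q0 qp p1 x0 xx1; have q1 := lt_trans qp p1.
have p0 := lt_trans q0 qp.
set r := dual_exponent q.
have rN : r != 0.
  by rewrite /r /dual_exponent mulf_neq0 ?oppr_eq0 ?invr_eq0 ?subr_eq0
     ?gt_eqF// ?(gt_eqF q1).
elim: n f g => [|n IHn] f g f0 g0.
  rewrite /correlated_mean /= -!powRrM (mulfV rN) mulfV ?(gt_eqF p0)//.
  by rewrite !powRr1// ltW.
pose N s h := binomial_mean al n (fun k => h k `^ s) `^ s^-1.
have Npos s h : (forall k, 0 < h k) -> 0 < N s h.
  by move=> h0; apply/powR_gt0/binomial_mean_gt0 => // k; exact: powR_gt0.
have NE s h : s != 0 -> (forall k, 0 < h k) ->
    N s h `^ s = binomial_mean al n (fun k => h k `^ s).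
  move=> s0 h0; rewrite /N -powRrM mulVf// powRr1// ltW//.
  by apply: binomial_mean_gt0 => // k; exact: powR_gt0.
have f0' k := f0 k.+1; have g0' k := g0 k.+1.
rewrite /= -(NE r f)// -(NE r (fun k => f k.+1))//.
rewrite -(NE p g) ?gt_eqF// -(NE p (fun k => g k.+1)) ?gt_eqF//.
apply: le_trans (two_point_two_function al01 q0 qp p1 x0 xx1 (Npos r _ f0')
  (Npos r _ f0) (Npos p _ g0') (Npos p _ g0)) _.
have x1 : x < 1.
  by apply: (le_lt_trans xx1); rewrite ltr_pdivrMr ?mulr_gt0//; nra.
have /andP[al0 al1] := al01.
have be0 : 0 <= x + (1 - x) * al by nra.
have be1 : 0 <= 1 - (x + (1 - x) * al) by nra.
have ga0 : 0 <= (1 - x) * al by nra.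
have ga1 : 0 <= 1 - (1 - x) * al by nra.
rewrite correlated_mean_succ//.
apply: lerD; (rewrite ler_wpM2l ?subr_ge0// mulrDr).
  by apply: lerD; rewrite mulrCA ler_wpM2l// IHn.
by apply: lerD; rewrite mulrCA ler_wpM2l// IHn.
Qed.

(** * Expectations on the natural numbers *)

Definition bdd {R : realType} (h : nat -> R) : Prop :=
  exists M : R, forall j, `|h j| <= M.

Lemma bdd_cst (R : realType) (a : R) : bdd (fun=> a).
Proof. by exists `|a|. Qed.

Lemma bddD (R : realType) (h h' : nat -> R) :
  bdd h -> bdd h' -> bdd (fun j => h j + h' j).
Proof.
move=> [M hM] [M' hM']; exists (M + M') => j.
by rewrite (le_trans (ler_normD _ _))// lerD.
Qed.

Lemma bddM (R : realType) (h h' : nat -> R) :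
  bdd h -> bdd h' -> bdd (fun j => h j * h' j).
Proof.
move=> [M hM] [M' hM']; exists (M * M') => j.
by rewrite normrM ler_pM.
Qed.

Lemma bddZ (R : realType) (a : R) (h : nat -> R) :
  bdd h -> bdd (fun j => a * h j).
Proof. by move=> hb; apply: bddM => //; exact: bdd_cst. Qed.

Lemma bdd_between (R : realType) (lo hi : R) (h : nat -> R) :
  (forall j, lo <= h j <= hi) -> bdd h.
Proof.
move=> hb; exists (`|lo| + `|hi|) => j; have /andP[h1 h2] := hb j.
rewrite ler_norml; have := ler_norm lo; have := ler_norm hi.
have := ler_norm (- lo); have := ler_norm (- hi); rewrite !normrN.
by move=> *; apply/andP; split; lra.
Qed.

Lemma bdd_bool (R : realType) (b : nat -> bool) : bdd (fun j => (b j)%:R : R).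
Proof. by exists 1 => j; case: (b j); rewrite ?normr1 ?normr0. Qed.

(** The rules of [averaging] restricted to bounded functions, so that integrals
    against a probability obey them as well. *)
Definition expectation {R : realType} (Phi : (nat -> R) -> R) : Prop :=
  [/\ forall h h', bdd h -> bdd h' ->
        Phi (fun j => h j + h' j) = Phi h + Phi h',
      forall a h, bdd h -> Phi (fun j => a * h j) = a * Phi h,
      forall h h', bdd h -> bdd h' -> (forall j, h j <= h' j) ->
        Phi h <= Phi h' &
      Phi (fun=> 1) = 1].

Lemma averaging_expectation (R : realType) (Phi : (nat -> R) -> R) :
  averaging Phi -> expectation Phi.
Proof. by move=> [D Z le e1]; split=> // *; auto. Qed.

Section expectation_theory.
Context {R : realType} (Phi : (nat -> R) -> R).
Hypothesis PhiE : expectation Phi.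

Lemma expectD h h' : bdd h -> bdd h' ->
  Phi (fun j => h j + h' j) = Phi h + Phi h'.
Proof. by move: PhiE => [D _ _ _]; exact: D. Qed.

Lemma expectZ a h : bdd h -> Phi (fun j => a * h j) = a * Phi h.
Proof. by move: PhiE => [_ Z _ _]; exact: Z. Qed.

Lemma expect_le h h' : bdd h -> bdd h' -> (forall j, h j <= h' j) ->
  Phi h <= Phi h'.
Proof. by move: PhiE => [_ _ le _]; exact: le. Qed.

Lemma expect_cst a : Phi (fun=> a) = a.
Proof.
have [_ _ _ e1] := PhiE.
rewrite -[RHS]mulr1 -e1 -expectZ; last exact: bdd_cst.
by congr Phi; apply/funext => j; rewrite mulr1.
Qed.

Lemma expect_bounds (lo hi : R) h : (forall j, lo <= h j <= hi) ->
  lo <= Phi h <= hi.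
Proof.
move=> hb; have hB := bdd_between hb.
rewrite -{1}[lo]expect_cst -[hi]expect_cst.
by apply/andP; split; apply: expect_le => //;
  (try exact: bdd_cst) => j; have /andP[] := hb j.
Qed.

Lemma bdd_sum N (c : nat -> R) :
  bdd (fun i => \sum_(j < N) c j * (i == j :> nat)%:R).
Proof.
elim: N => [|N IHN].
  by exists 0 => j; rewrite big_ord0 normr0.
under eq_fun do rewrite big_ord_recr/=.
by apply: bddD => //; apply: bddZ; exact: bdd_bool.
Qed.

Lemma expect_sum N (c : nat -> R) :
  Phi (fun i => \sum_(j < N) c j * (i == j :> nat)%:R) =
  \sum_(j < N) c j * Phi (fun i => (i == j :> nat)%:R).
Proof.
elim: N => [|N IHN].
  rewrite big_ord0 -[RHS](expect_cst 0).
  by congr Phi; apply/funext => i; rewrite big_ord0.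
rewrite big_ord_recr/= -IHN -expectZ; last exact: bdd_bool.
rewrite -expectD; [|exact: bdd_sum|by apply: bddZ; exact: bdd_bool].
by congr Phi; apply/funext => i; rewrite big_ord_recr.
Qed.

Lemma sum_indic (i N : nat) (c : nat -> R) :
  \sum_(j < N) c j * (i == j :> nat)%:R = if (i < N)%N then c i else 0.
Proof.
elim: N => [|N IHN]; first by rewrite big_ord0.
rewrite big_ord_recr/= IHN ltnS.
by case: (ltngtP i N) => [_|_|->]; rewrite ?mulr0 ?addr0 ?mulr1 ?add0r.
Qed.

(** h lies between - M + \sum_(j < N) (h j + M) 1_j and
    M + \sum_(j < N) (h j - M) 1_j. *)
Lemma expect_tail N (M : R) h : (forall j, `|h j| <= M) ->
  `|Phi h - \sum_(j < N) h j * Phi (fun i => (i == j :> nat)%:R)| <=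
  M * (1 - \sum_(j < N) Phi (fun i => (i == j :> nat)%:R)).
Proof.
move=> hM; have hB : bdd h by exists M.
set w := fun j => Phi (fun i => (i == j :> nat)%:R).
have up : Phi h <= M + \sum_(j < N) (h j - M) * w j.
  rewrite /w -(expect_sum N (fun j => h j - M)) -[X in X + _]expect_cst -expectD;
    [|exact: bdd_cst|exact: (bdd_sum _ (fun j => h j - M))].
  apply: expect_le => //.
    by apply: bddD; [exact: bdd_cst|exact: (bdd_sum _ (fun j => h j - M))].
  move=> i; rewrite (sum_indic i N (fun j => h j - M)); have := hM i.
  by rewrite ler_norml => /andP[_ ?]; case: ifP => _; lra.
have lo : - M + \sum_(j < N) (h j + M) * w j <= Phi h.
  rewrite /w -(expect_sum N (fun j => h j + M)) -[X in X + _]expect_cst -expectD;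
    [|exact: bdd_cst|exact: (bdd_sum _ (fun j => h j + M))].
  apply: expect_le => //.
    by apply: bddD; [exact: bdd_cst|exact: (bdd_sum _ (fun j => h j + M))].
  move=> i; rewrite (sum_indic i N (fun j => h j + M)); have := hM i.
  by rewrite ler_norml => /andP[? _]; case: ifP => _; lra.
move: up lo; under eq_bigr do rewrite mulrBl.
under [in X in _ -> X -> _]eq_bigr do rewrite mulrDl.
rewrite sumrB big_split/= -!mulr_sumr => up lo.
by rewrite ler_norml -/w; apply/andP; split; lra.
Qed.

End expectation_theory.

Definition pmf {R : realType} (nu : probability nat R) (j : nat) : R :=
  fine (nu [set j]).

Section integral_nat.
Context {R : realType} (nu : probability nat R).

Lemma bdd_integrable (A : set nat) h : bdd h -> nu.-integrable A (EFin \o h).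
Proof.
move=> [M hM]; apply: measurable_bounded_integrable => //.
  by rewrite (le_lt_trans (probability_le1 _ _))// ltry.
exists M; split; first by rewrite num_real.
by move=> x Mx j _ /=; rewrite (le_trans (hM j))// ltW.
Qed.

Lemma integral_expectation : expectation (fun h => \int[nu]_j h j).
Proof.
split=> [h h' hb hb'|a h hb|h h' hb hb' hh'|].
- by rewrite RintegralD//; exact: bdd_integrable.
- by rewrite RintegralZl//; exact: bdd_integrable.
- by apply: le_Rintegral => //; exact: bdd_integrable.
- by rewrite Rintegral_cst// mul1r; exact: (congr1 fine (probability_setT nu)).
Qed.

Lemma integral_indic (A : set nat) :
  \int[nu]_j (\1_A j : R) = fine (nu A).
Proof. by rewrite /Rintegral integral_indic// setIT. Qed.

Lemma integral_point j : \int[nu]_i ((i == j)%:R : R) = pmf nu j.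
Proof.
rewrite /pmf -integral_indic; apply: eq_Rintegral => i _.
by rewrite indicE; congr (nat_of_bool _)%:R; apply/eqP/idP; rewrite inE.
Qed.

Lemma pmf_ge0 j : 0 <= pmf nu j.
Proof. exact: fine_ge0. Qed.

Lemma pmf_mass : \sum_(j < N) pmf nu j @[N --> \oo] --> (1 : R).
Proof.
have -> : (fun N => \sum_(j < N) pmf nu j) = fine \o (nu \o (fun N => `I_N)).
  apply/funext => N /=; rewrite -integral_indic.
  transitivity (\sum_(j < N) 1 * \int[nu]_i ((i == j :> nat)%:R : R)).
    by apply: eq_bigr => j _; rewrite mul1r integral_point.
  rewrite -(expect_sum integral_expectation N (fun=> 1)).
  apply: eq_Rintegral => i _; rewrite (sum_indic i N (fun=> 1)) indicE.
  by case: ifP => iN; [rewrite mem_set|rewrite memNset// /= iN].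
have nuT : (nu \o (fun N => `I_N)) x @[x --> \oo] --> 1%E.
  rewrite -(probability_setT nu).
  have -> : [set: nat] = \bigcup_n `I_n.
    by apply/seteqP; split => // j _; exists j.+1 => //=.
  apply: nondecreasing_cvg_mu => // m n mn; apply/subsetPset => j /= jm.
  exact: leq_trans jm mn.
exact: (fine_cvg nuT).
Qed.

End integral_nat.

Lemma cvg_fin_sum (R : realType) (T : Type) (F : set_system T)
    (FF : Filter F) (N : nat) (u : T -> nat -> R) (l : nat -> R) :
  (forall j, u t j @[t --> F] --> l j) ->
  \sum_(j < N) u t j @[t --> F] --> \sum_(j < N) l j.
Proof.
move=> ul; elim: N => [|N IHN].
  by under eq_fun do rewrite big_ord0; rewrite big_ord0; exact: cvg_cst.
under eq_fun do rewrite big_ord_recr/=.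
by rewrite big_ord_recr/=; exact: cvgD.
Qed.

(** The limit masses add up to 1, so that no mass can escape to infinity and the
    convergence is in total variation. This is why the integrand may vary with
    n as long as it stays bounded. *)
Lemma expectation_limit (R : realType) (nu : probability nat R)
    (Phi : nat -> (nat -> R) -> R) (h : nat -> nat -> R) (h0 : nat -> R)
    (M : R) :
  (forall n, expectation (Phi n)) ->
  (forall j, Phi n (fun i => (i == j)%:R) @[n --> \oo] --> pmf nu j) ->
  (forall n j, `|h n j| <= M) ->
  (forall j, h n j @[n --> \oo] --> h0 j) ->
  Phi n (h n) @[n --> \oo] --> \int[nu]_j h0 j.
Proof.
move=> PhiE Phi1 hM hcvg.
have h0M j : `|h0 j| <= M.
  by apply: cvgr_to_le (cvg_norm (hcvg j)) _; apply: nearW => n; exact: hM.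
have w_mass := pmf_mass nu.
apply/cvgrPdist_le => e e0.
have M1 : 0 < M + 1 by have := le_trans (normr_ge0 _) (h0M 0%N); lra.
have e' : 0 < e / (4 * (M + 1)) by rewrite divr_gt0 ?mulr_gt0.
have /cvgrPdist_le/(_ _ e')[N _ /(_ N (leqnn N)) hN] := w_mass.
pose S n := \sum_(j < N) h n j * Phi n (fun i => (i == j :> nat)%:R).
pose T n := \sum_(j < N) Phi n (fun i => (i == j :> nat)%:R).
pose S0 := \sum_(j < N) h0 j * pmf nu j.
pose T0 := \sum_(j < N) pmf nu j.
have ST : S n @[n --> \oo] --> S0.
  apply: (@cvg_fin_sum R nat \oo _ N
    (fun n j => h n j * Phi n (fun i => (i == j)%:R))
    (fun j => h0 j * pmf nu j)) => j.
  by apply: cvgM; [exact: hcvg|exact: Phi1].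
have TT : T n @[n --> \oo] --> T0.
  exact: (@cvg_fin_sum R nat \oo _ N
    (fun n j => Phi n (fun i => (i == j)%:R)) (fun j => pmf nu j) Phi1).
have e4 : 0 < e / 4 by rewrite divr_gt0.
near=> n.
have hS : `|S0 - S n| <= e / 4 by near: n; move/cvgrPdist_le : ST; exact.
have hT : `|T0 - T n| <= e / (4 * (M + 1)).
  by near: n; move/cvgrPdist_le : TT; exact.
have tail0 : `|\int[nu]_j h0 j - S0| <= M * (1 - T0).
  have := expect_tail (integral_expectation nu) N h0M.
  under eq_bigr do rewrite integral_point.
  by under [X in _ <= _ * (_ - X)]eq_bigr do rewrite integral_point.
have tailn : `|Phi n (h n) - S n| <= M * (1 - T n).
  exact: (expect_tail (PhiE n) N (hM n)).
have -> : \int[nu]_j h0 j - Phi n (h n) =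
   (\int[nu]_j h0 j - S0) + (S0 - S n) - (Phi n (h n) - S n) by ring.
apply: (le_trans (ler_normB _ _)); apply: le_trans (lerD (ler_normD _ _) (lexx _)) _.
have M0 := le_trans (normr_ge0 _) (h0M 0%N).
have b0 : 1 - T0 <= e / (4 * (M + 1)) by exact: le_trans (ler_norm _) hN.
have bn : 1 - T n <= 2 * (e / (4 * (M + 1))).
  by have := ler_norm (T0 - T n); move: hT b0; lra.
have := ler_wpM2l M0 b0; have := ler_wpM2l M0 bn.
have : M * (e / (4 * (M + 1))) <= e / 4.
  have -> : e / 4 = (M + 1) * (e / (4 * (M + 1))) by field; rewrite gt_eqF.
  by rewrite ler_pM2r//; lra.
lra.
Unshelve. all: by end_near. Qed.

(** * From sites to the Poisson law *)

Section poisson_limit.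
Context {R : realType}.

Definition poisson_weight (c : R) (j : nat) : R := c ^+ j / j`!%:R * expR (- c).

Lemma pmf_Poi (lam : R) j : 0 < lam -> pmf (Poi lam) j = poisson_weight lam j.
Proof.
move=> lam0; rewrite /pmf /Poi /= /poisson_prob lam0 esum_set1/=.
  by rewrite /poisson_pmf lam0.
by rewrite lee_fin poisson_pmf_ge0.
Qed.

Lemma binomial_mean0 (c : R) m : binomial_mean c m (fun=> 0) = 0.
Proof. by elim: m => //= m ->; ring. Qed.

Lemma binomial_mean_point (c : R) m j :
  binomial_mean c m (fun i => (i == j)%:R) =
  'C(m, j)%:R * c ^+ j * (1 - c) ^+ (m - j).
Proof.
elim: m j => [|m IHm] [|j] /=.
- by rewrite bin0 expr0 !mul1r subnn expr0.
- by rewrite !mul0r.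
- by rewrite binomial_mean0 IHm !bin0 !subn0 !expr0 exprS; ring.
- rewrite [X in c * X]IHm IHm binS natrD subSS.
  have [mj|jm] := leqP m j.
    rewrite (@bin_small m j.+1)//; have -> : (m - j = 0)%N by apply/eqP.
    by rewrite exprS; ring.
  have -> : (m - j = (m - j.+1).+1)%N by rewrite subnSK.
  by rewrite !exprS; ring.
Qed.

Lemma cvg_inv_shift K : (((n + K.+1)%:R)^-1 : R) @[n --> \oo] --> (0 : R).
Proof.
under eq_fun do rewrite addnS.
exact: (cvg_comp _ _ (cvg_addnr K) (@cvg_harmonic R)).
Qed.

Lemma cvg_div_shift (c : R) K :
  c / ((n + K.+1)%:R) @[n --> \oo] --> (0 : R).
Proof. by rewrite -[0](mulr0 c); apply: cvgMr; exact: cvg_inv_shift. Qed.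

(** With y = c / m, the power is squeezed by 1 - y <= exp (- y) and
    1 / (1 - y) <= exp (y / (1 - y)). The shift by K keeps y below 1. *)
Lemma cvg_one_minus (c : R) K : 0 <= c -> c < K.+1%:R ->
  (1 - c / ((n + K.+1)%:R)) ^+ (n + K.+1) @[n --> \oo] --> expR (- c).
Proof.
move=> c0 cK.
have lt1 n : c / ((n + K.+1)%:R) < 1.
  rewrite ltr_pdivrMr ?mul1r; last by rewrite ltr0n addnS.
  by rewrite (lt_le_trans cK)// ler_nat leq_addl.
apply: (@squeeze_cvgr _ _ _ _ (fun n => expR (- (c / (1 - c / ((n + K.+1)%:R)))))
   (fun=> expR (- c))).
- apply: nearW => n; set m := (n + K.+1)%N; set y := c / m%:R.
  have m0 : (0 : R) < m%:R by rewrite ltr0n /m addnS.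
  have y1 : 0 < 1 - y by rewrite subr_gt0 lt1.
  have cE : c = m%:R * y by rewrite /y mulrCA divff ?mulr1// gt_eqF.
  apply/andP; split; last first.
    rewrite cE -(mulrN m%:R) expRM_natl lerXn2r ?nnegrE ?expR_ge0 ?(ltW y1)//.
    exact: expR_ge1Dx.
  rewrite {1}cE -mulrA -(mulrN m%:R) expRM_natl lerXn2r ?nnegrE ?expR_ge0 ?(ltW y1)//.
  rewrite expRN -[leRHS]invrK lef_pV2 ?posrE ?invr_gt0 ?expR_gt0//.
  have E : (1 - y)^-1 = 1 + y / (1 - y) by field; rewrite gt_eqF.
  rewrite [leLHS]E; exact: expR_ge1Dx.
- apply: continuous_cvg; first exact: continuous_expR.
  apply: cvgN; rewrite -[X in _ --> X](divr1 c).
  apply: cvgMr; apply: cvgV; first by rewrite oner_eq0.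
  by rewrite -[X in _ --> X](subr0 1); apply: cvgB; [exact: cvg_cst|exact: cvg_div_shift].
- exact: cvg_cst.
Qed.

(** Induction on j: r n is the ratio of consecutive binomial masses. *)
Lemma binomial_mean_point_limit (c : R) K j : 0 <= c -> c < K.+1%:R ->
  binomial_mean (c / (n + K.+1)%:R) (n + K.+1) (fun i => (i == j)%:R)
    @[n --> \oo] --> poisson_weight c j.
Proof.
move=> c0 cK; elim: j => [|j IHj].
  rewrite /poisson_weight expr0 fact0 divr1 mul1r.
  under eq_fun do rewrite binomial_mean_point bin0 expr0 mulr1 mul1r subn0.
  exact: cvg_one_minus.
have lt1 n : c / ((n + K.+1)%:R) < 1.
  rewrite ltr_pdivrMr ?mul1r; last by rewrite ltr0n addnS.
  by rewrite (lt_le_trans cK)// ler_nat leq_addl.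
have -> : poisson_weight c j.+1 =
    poisson_weight c j * ((1 - 0) * (c / j.+1%:R) / (1 - 0)).
  have : (j.+1%:R : R) != 0 by rewrite pnatr_eq0.
  have : (j`!%:R : R) != 0 by rewrite pnatr_eq0 -lt0n fact_gt0.
  rewrite /poisson_weight exprS factS natrM.
  move: (j.+1%:R : R) (j`!%:R : R) => u v v0 u0.
  by field; rewrite u0 v0.
pose r n := (1 - j%:R / (n + K.+1)%:R) * (c / j.+1%:R) /
   (1 - c / (n + K.+1)%:R).
have : binomial_mean (c / (n + K.+1)%:R) (n + K.+1) (fun i => (i == j)%:R) * r n
    @[n --> \oo] --> poisson_weight c j * ((1 - 0) * (c / j.+1%:R) / (1 - 0)).
  apply: cvgM => //; apply: cvgM.
    apply: cvgMl; apply: cvgB; [exact: cvg_cst|exact: cvg_div_shift].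
  apply: cvgV; first by rewrite subr0 oner_eq0.
  apply: cvgB; [exact: cvg_cst|exact: cvg_div_shift].
apply: cvg_trans; apply: near_eq_cvg; near=> n.
have jn : (j < n)%N by near: n; exact: nbhs_infty_gt.
rewrite !binomial_mean_point /r; set m := (n + K.+1)%N; set y := c / m%:R.
have jm : (j < m)%N by rewrite (leq_trans jn)// leq_addr.
have m0 : m%:R != 0 :> R by rewrite pnatr_eq0 -lt0n (leq_trans _ jm).
have y1 : 1 - y != 0 by rewrite gt_eqF// subr_gt0 lt1.
have j0 : j.+1%:R != 0 :> R by rewrite pnatr_eq0.
have -> : 'C(m, j.+1)%:R = (m%:R - j%:R) * 'C(m, j)%:R / j.+1%:R :> R.
  rewrite -natrB; last exact: ltnW.
  by rewrite -natrM -mul_bin_left natrM mulrAC divff// mul1r.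
have -> : (m - j = (m - j.+1).+1)%N by rewrite subnSK.
have -> : c = m%:R * y by rewrite /y mulrCA divff ?mulr1.
rewrite !exprS; move: (j.+1%:R : R) j0 => u u0; field.
by rewrite m0 y1 u0.
Unshelve. all: by end_near. Qed.

End poisson_limit.

(** The mass at j of the convolution of Bin(k, x) and Poi(c), obtained by
    conditioning on one of the k Bernoulli variables. *)
Fixpoint mehler_weight {R : realType} (x c : R) (k j : nat) : R :=
  if k is k'.+1 then
    x * (if j is j'.+1 then mehler_weight x c k' j' else 0) +
    (1 - x) * mehler_weight x c k' j
  else poisson_weight c j.

Section binomial_to_poisson.
Context {R : realType} (lam x : R) (K : nat).
Hypotheses (lam0 : 0 < lam) (lamK : lam < K.+1%:R) (x0 : 0 <= x) (x1 : x <= 1).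

Let m n := (n + K.+1)%N.
Let al n : R := lam / (m n)%:R.
Let be n : R := x + (1 - x) * al n.
Let ga n : R := (1 - x) * al n.

Let al01 n : 0 <= al n <= 1.
Proof.
have m0 : (0 : R) < (m n)%:R by rewrite ltr0n /m addnS.
rewrite divr_ge0 ?(ltW lam0)//= ler_pdivrMr// mul1r ltW//.
by rewrite (lt_le_trans lamK)// ler_nat leq_addl.
Qed.

Let be01 n : 0 <= be n <= 1.
Proof.
rewrite /be; move: (al n) (al01 n) => a /andP[a0 a1].
have x1' : 0 <= 1 - x by rewrite subr_ge0.
have a1' : 0 <= 1 - a by rewrite subr_ge0.
have := mulr_ge0 x1' a0; have := mulr_ge0 x1' a1'.
by move: x0 x1 => *; apply/andP; split; lra.
Qed.

Let ga01 n : 0 <= ga n <= 1.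
Proof.
rewrite /ga; move: (al n) (al01 n) => a /andP[a0 a1].
have x1' : 0 <= 1 - x by rewrite subr_ge0.
have a1' : 0 <= 1 - a by rewrite subr_ge0.
have := mulr_ge0 x1' a0; have := mulr_ge0 x1' a1'.
by move: x0 x1 => *; apply/andP; split; lra.
Qed.

Let ga_cvg0 : ga n @[n --> \oo] --> (0 : R).
Proof. by rewrite -(mulr0 (1 - x)); apply: cvgMr; exact: cvg_div_shift. Qed.

Let be_cvg : be n @[n --> \oo] --> x.
Proof. by rewrite -[X in _ --> X]addr0; apply: cvgD; [exact: cvg_cst|]. Qed.

Lemma indic_bounds j i : 0 <= ((i == j :> nat)%:R : R) <= 1.
Proof. by case: (i == j); rewrite ?lexx ?ler01. Qed.

(** Dropping one site changes the mean by at most the parameter of that site,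
    which tends to 0. *)
Let binomial_mean_shift k0 j :
  binomial_mean (ga n) (m n - k0) (fun i => (i == j)%:R) @[n --> \oo] -->
  poisson_weight ((1 - x) * lam) j.
Proof.
elim: k0 => [|k0 IHk0].
  under eq_fun do rewrite subn0 /ga /al mulrA.
  apply: binomial_mean_point_limit; first by rewrite mulr_ge0 ?subr_ge0// ltW.
  by apply: le_lt_trans lamK; rewrite ler_piMl ?(ltW lam0)// gerBl.
pose d n := binomial_mean (ga n) (m n - k0.+1) (fun i => (i.+1 == j)%:R) -
  binomial_mean (ga n) (m n - k0.+1) (fun i => (i == j)%:R).
have : binomial_mean (ga n) (m n - k0) (fun i => (i == j)%:R) - ga n * d n @[n --> \oo]
    --> poisson_weight ((1 - x) * lam) j - 0.
  apply: cvgB => //.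
  apply: (@squeeze_cvgr _ _ _ _ (fun n => - ga n) ga) => //.
  - apply: nearW => n; have /andP[g0 g1] := ga01 n.
    have /andP[] := expect_bounds (averaging_expectation
      (averaging_binomial_mean (m n - k0.+1) (ga01 n))) (indic_bounds j).
    have /andP[] := expect_bounds (averaging_expectation
      (averaging_binomial_mean (m n - k0.+1) (ga01 n))) (fun i => indic_bounds j i.+1).
    rewrite /d; set u := binomial_mean _ _ _; set v := binomial_mean _ _ _ => u0 u1 v0 v1.
    have h1 : -1 <= u - v by lra.
    have h2 : u - v <= 1 by lra.
    have := ler_wpM2l g0 h1; have := ler_wpM2l g0 h2.
    by rewrite mulrN !mulr1 => -> ->.
  - by rewrite -oppr0; apply: cvgN.
rewrite subr0; apply: cvg_trans; apply: near_eq_cvg; near=> n.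
have kn : (k0 < m n)%N.
  by rewrite /m ltn_addr//; near: n; exact: nbhs_infty_gt.
by rewrite -(subnSK kn) /= /d; ring.
Unshelve. all: by end_near. Qed.

Lemma two_binomial_mean_point_limit k0 k j :
  two_binomial_mean (be n) (ga n) k (m n - k0) (fun i => (i == j)%:R) @[n --> \oo] -->
  mehler_weight x ((1 - x) * lam) k j.
Proof.
elim: k j => [|k IHk] j; first exact: binomial_mean_shift.
rewrite /=; apply: cvgD; apply: cvgM => //; last first.
  by apply: cvgB => //; exact: cvg_cst.
case: j => [|j]; last exact: IHk.
have two_binomial_mean0 n l : two_binomial_mean (be n) (ga n) l (m n - k0) (fun=> 0) = 0.
  by elim: l => [|l IHl] /=; [exact: binomial_mean0|rewrite IHl; ring].
by under eq_fun do rewrite [two_binomial_mean _ _ _ _ _]two_binomial_mean0;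
  exact: cvg_cst.
Qed.

Lemma correlated_mean_limit (nu : nat -> probability nat R) (f g : nat -> R) :
  (forall k j, pmf (nu k) j = mehler_weight x ((1 - x) * lam) k j) ->
  bdd f -> bdd g ->
  correlated_mean (al n) x (m n) f g @[n --> \oo] -->
  \int[Poi lam]_k (f k * \int[nu k]_j g j).
Proof.
move=> nuE [Mf fM] [Mg gM].
have Mg0 := le_trans (normr_ge0 _) (gM 0%N).
have Mf0 := le_trans (normr_ge0 _) (fM 0%N).
apply: (@expectation_limit R _ (fun n => binomial_mean (al n) (m n))
  (fun n k => f k * two_binomial_mean (be n) (ga n) k (m n - k) g) _ (Mf * Mg)).
- by move=> n; apply/averaging_expectation/averaging_binomial_mean.
- by move=> j; rewrite pmf_Poi//; apply: binomial_mean_point_limit => //; exact: ltW.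
- move=> n k; rewrite normrM ler_pM// ler_norml.
  apply: expect_bounds.
    by apply/averaging_expectation/averaging_two_binomial_mean.
  by move=> j; rewrite -ler_norml.
- move=> k; apply: cvgMr.
  apply: (@expectation_limit R _ (fun n => two_binomial_mean (be n) (ga n) k (m n - k))
     (fun=> g) _ Mg) => //.
  + by move=> n; apply/averaging_expectation/averaging_two_binomial_mean.
  + by move=> j; rewrite nuE; exact: two_binomial_mean_point_limit.
  + by move=> j; exact: cvg_cst.
Qed.

Lemma binomial_mean_limit (f : nat -> R) : bdd f ->
  binomial_mean (al n) (m n) f @[n --> \oo] --> \int[Poi lam]_k f k.
Proof.
move=> [M fM].
apply: (@expectation_limit R _ (fun n => binomial_mean (al n) (m n)) (fun=> f) _ M) => //.
- by move=> n; apply/averaging_expectation/averaging_binomial_mean.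
- by move=> j; rewrite pmf_Poi//; apply: binomial_mean_point_limit => //; exact: ltW.
- by move=> j; exact: cvg_cst.
Qed.

End binomial_to_poisson.

(** * A maximum principle for the backward equation *)

(** This is - L. *)
Definition generator {R : realType} (lam : R) (u : nat -> R) (k : nat) : R :=
  lam * (u k.+1 - u k) + k%:R * (u k.-1 - u k).

Lemma right_derivative_cvg (R : realType) (f : R -> R) (t l : R) :
  (f (t + h) - f t) / h @[h --> 0^'+] --> l ->
  f (t + h) @[h --> 0^'+] --> f t.
Proof.
move=> dl; rewrite -[X in _ --> X]addr0 -[X in _ + X](mulr0 l).
have h0 : h @[h --> (0 : R)^'+] --> (0 : R) by exact: cvg_at_right_filter.
have : f t + (f (t + h) - f t) / h * h @[h --> 0^'+] --> f t + l * 0.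
  by apply: cvgD; [exact: cvg_cst|exact: cvgM].
apply: cvg_trans; apply: near_eq_cvg; near=> h.
have hN : h != 0 by rewrite gt_eqF//; near: h; exact: nbhs_right_gt.
by rewrite mulfVK// subrKC.
Unshelve. all: by end_near. Qed.

(** Let tau be the last time up to which w <= 0. Where w vanishes at time tau,
    its right derivative is negative, because [generator] is nonpositive at a
    maximum; where it is negative, it stays so for a while. As only the states
    below N matter, w <= 0 persists beyond tau. Right derivatives suffice for
    this, together with left continuity, which carries w <= 0 to tau itself. *)
Lemma strict_maximum_principle (R : realType) (lam : R) (w : R -> nat -> R)
    (dw : R -> nat -> R) (N : nat) (T : R) : 0 < lam ->
  (forall k, w 0 k <= 0) ->
  (forall t k, 0 <= t -> t <= T -> (N <= k)%N -> w t k <= 0) ->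
  (forall t k, 0 <= t ->
    (w (t + h) k - w t k) / h @[h --> 0^'+] --> dw t k) ->
  (forall t k, 0 <= t -> dw t k < generator lam (w t) k) ->
  (forall t k, 0 < t -> w (t - h) k @[h --> 0^'+] --> w t k) ->
  0 <= T -> forall k, w T k <= 0.
Proof.
move=> lam0 w0 wN wd dwlt wl T0.
(* the times up to which w is nonpositive *)
pose S := [set t | [/\ 0 <= t, t <= T & forall s k, 0 <= s -> s <= t -> w s k <= 0]].
have S0 : S 0.
  split=> // s k s0 s1; suff -> : s = 0 by [].
  by apply/eqP; rewrite eq_le s0 s1.
have Sub : has_ubound S by exists T => t [].
have tau0 : 0 <= sup S by exact: ub_le_sup.
have tauT : sup S <= T by apply: ge_sup; [exists 0|move=> t []].
set tau := sup S in tau0 tauT.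
have below s k : 0 <= s -> s < tau -> w s k <= 0.
  move=> s0 st.
  have [e Se] := @sup_adherent R S (tau - s) ltac:(by rewrite subr_gt0)
    (conj (ex_intro _ _ S0) Sub).
  rewrite -/tau opprB addrC subrK => se.
  by case: Se => _ _; apply; rewrite ?(ltW se).
have attau k : w tau k <= 0.
  have := tau0; rewrite le_eqVlt => /predU1P[<-//|tau_gt0].
  apply: (cvgr_to_le (wl _ k tau_gt0)); near=> h; apply: below.
    by rewrite subr_ge0 ltW//; near: h; exact: nbhs_right_lt.
  by rewrite ltrBlDr ltrDl; near: h; exact: nbhs_right_gt.
suff tauE : T <= tau.
  by have -> : T = tau by apply/eqP; rewrite eq_le tauE tauT.
rewrite leNgt; apply/negP => ltauT.
have after k : \forall h \near 0^'+, w (tau + h) k <= 0.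
  have [wlt0|wge0] := ltP (w tau k) 0.
    have := @right_derivative_cvg R (w ^~ k) _ _ (wd _ k tau0) => /cvgr_lt /(_ _ wlt0).
    by apply: filterS => h /ltW.
  have wE : w tau k = 0 by apply/eqP; rewrite eq_le attau wge0.
  have dneg : dw tau k < 0.
    apply: (lt_le_trans (dwlt _ k tau0)).
    rewrite /generator wE !subr0 -[leRHS]addr0.
    by apply: lerD; [rewrite pmulr_rle0|rewrite mulr_ge0_le0].
  near=> h.
  have h0 : 0 < h by near: h; exact: nbhs_right_gt.
  have : (w (tau + h) k - w tau k) / h < 0.
    by near: h; have /cvgr_lt := wd _ k tau0; exact.
  by rewrite wE subr0 pmulr_llt0 ?invr_gt0// => /ltW.
have : \forall h \near 0^'+, forall k : 'I_N, w (tau + h) k <= 0.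
  by apply: filter_forall => k; exact: after.
move=> afterN.
have [d d0 dP] : exists2 d, 0 < d & forall h, 0 < h -> h < d ->
    forall k, w (tau + h) k <= 0.
  have [d /= d0 dP] := afterN.
  exists (Num.min d (T - tau)); first by rewrite lt_min d0 subr_gt0.
  move=> h h0; rewrite lt_min => /andP[hd hT] k.
  have [kN|Nk] := ltnP k N; last first.
    by apply: wN => //; [rewrite addr_ge0 ?(ltW h0)|rewrite -lerBrDl ltW].
  apply: (dP h _ h0 (Ordinal kN)).
  by rewrite /= sub0r normrN gtr0_norm.
pose e := Num.min (d / 2) (T - tau).
have e0 : 0 < e by rewrite lt_min subr_gt0 ltauT divr_gt0.
have ed : e < d by rewrite gt_min ltr_pdivrMr// ltr_pMr// ltr1n.
suff : S (tau + e).
  by move=> /(ub_le_sup Sub); rewrite -/tau leNgt ltrDl e0.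
split=> [||s k s0 st].
- by rewrite addr_ge0 ?(ltW e0).
- by rewrite -lerBrDl ge_min lexx orbT.
- have [stau|taus] := ltP s tau; first exact: below.
  have := taus; rewrite le_eqVlt => /predU1P[<-|taus']; first exact: attau.
  rewrite -(subrKC tau s); apply: dP; first by rewrite subr_gt0.
  by rewrite (le_lt_trans _ ed)// lerBlDl.
Unshelve. all: by end_near. Qed.

Lemma is_derive_right (R : realType) (f : R -> R) (t l : R) :
  is_derive t 1 f l -> (f (t + h) - f t) / h @[h --> 0^'+] --> l.
Proof.
move=> [df <-].
have H : h^-1 *: ((f \o shift t) (h *: 1) - f t) @[h --> (0:R)^'+] --> 'D_1 f t.
  exact: cvg_dnbhs_at_right df.
apply: cvg_trans H; apply: near_eq_cvg; near=> h.
by rewrite /= -![_ *: _]/(_ * _) mulr1 mulrC (addrC h).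
Unshelve. all: by end_near. Qed.

Lemma generator_succn (R : realType) (lam : R) k :
  generator lam (fun i => i.+1%:R) k = lam - k%:R.
Proof.
rewrite /generator; case: k => [|k] /=; first by rewrite mul0r subr0 addr0 -natrB// mulr1.
by rewrite -!natr1; ring.
Qed.

(** Subtract e exp ((lam + 1) t) (k + 1) from u. As [generator] maps k + 1 to
    lam - k < (lam + 1) (k + 1), the difference satisfies the strict inequality,
    and as u is bounded it is nonpositive for large k. Let e tend to 0. *)
Lemma maximum_principle (R : realType) (lam B : R) (u : R -> nat -> R) :
  0 < lam ->
  (forall k, u 0 k <= 0) ->
  (forall (t : R) k, 0 <= t -> u t k <= B) ->
  (forall (t : R) k, 0 <= t ->
    (u (t + h) k - u t k) / h @[h --> 0^'+] --> generator lam (u t) k) ->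
  (forall (t : R) k, 0 < t -> u (t - h) k @[h --> 0^'+] --> u t k) ->
  forall t k, 0 <= t -> u t k <= 0.
Proof.
move=> lam0 u0 uB ud ul T k0 T0.
apply/ler_addgt0Pl => e' e'0; rewrite addr0.
set c := lam + 1; pose E t := expR (c * t).
have E0 t : 0 < E t by exact: expR_gt0.
pose C := E T * k0.+1%:R.
have C0 : 0 < C by rewrite mulr_gt0.
pose e := e' / C.
have e0 : 0 < e by rewrite divr_gt0.
have dE (t : R) : is_derive t 1 E (c * E t).
  rewrite /E; apply: is_derive_eq.
  by rewrite -![_ *: _]/(_ * _) mulr1 mulrC.
pose w t k := u t k - e * (E t * k.+1%:R).
pose dw t k := generator lam (u t) k - e * (c * E t * k.+1%:R).
(* beyond N the perturbation alone exceeds the bound B on u *)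
pose N := Num.bound (B / e).
suff : w T k0 <= 0.
  by rewrite subr_le0 -/C /e mulfVK// gt_eqF.
apply: (@strict_maximum_principle R lam w dw N T) => //.
- move=> k; rewrite /w; have := u0 k.
  by have := mulr_gt0 e0 (mulr_gt0 (E0 0) (ltr0Sn R k)); lra.
- move=> t k t0 tT Nk; rewrite subr_le0 (le_trans (uB t k t0))//.
  rewrite -ler_pdivrMl// mulrC.
  have E1 : 1 <= E t.
    by rewrite -[leLHS]expR0 ler_expR mulr_ge0// addr_ge0// ltW.
  apply: (@le_trans _ _ k.+1%:R); last by rewrite ler_peMl.
  have [B0|B0] := leP 0 (B / e); last by rewrite ltW// (lt_trans B0).
  by rewrite ltW// (lt_le_trans (archi_boundP B0))// ler_nat ltnW.
- move=> t k t0.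
  have -> : (fun h => (w (t + h) k - w t k) / h) =
    (fun h => (u (t + h) k - u t k) / h -
       e * ((E (t + h) - E t) / h * k.+1%:R)).
    by apply/funext => h; rewrite /w; ring.
  apply: cvgB; first exact: ud.
  by apply: cvgMr; apply: cvgMl; exact: is_derive_right.
- move=> t k t0.
  have -> : generator lam (w t) k = generator lam (u t) k -
     e * E t * generator lam (fun i => i.+1%:R) k.
    by rewrite /generator /w; ring.
  rewrite generator_succn /dw ltrD2l ltrN2.
  have -> : e * (c * E t * k.+1%:R) = e * E t * (c * k.+1%:R) by ring.
  rewrite ltr_pM2l ?(mulr_gt0 e0 (E0 t))//.
  have k_ge0 : 0 <= (k%:R : R) by [].
  by rewrite /c -natr1; nra.
- move=> t k t0; apply: cvgB; first exact: ul.
  apply: cvgMr; apply: cvgMl.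
  have cE : {for t, continuous E}.
    by have ? := dE t; apply/differentiable_continuous/derivable1_diffP/ex_derive.
  apply: (@cvg_comp _ _ _ (fun h => t - h) E (0^'+) (nbhs t)) => //.
  apply: cvg_at_right_filter; rewrite -[X in _ --> X]subr0.
  by apply: cvgB; [exact: cvg_cst|exact: cvg_id].
Qed.

(** * The transition probabilities of the queue *)

Lemma is_derive_poisson_weight (R : realType) (c : R) j :
  is_derive c 1 (poisson_weight ^~ j)
    ((if j is j'.+1 then poisson_weight c j' else 0) - poisson_weight c j).
Proof.
have dN : is_derive c 1 (fun c : R => expR (- c)) (- expR (- c)).
  by apply: is_derive_eq; rewrite mulrN1.
case: j => [|j]; rewrite /poisson_weight.
  have -> : (fun c : R => c ^+ 0 / 0`!%:R * expR (- c)) = (fun c => expR (- c)).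
    by apply/funext => d; rewrite expr0 fact0 divr1 mul1r.
  by apply: is_derive_eq; rewrite expr0 fact0; field.
have -> : (fun c : R => c ^+ j.+1 / j.+1`!%:R * expR (- c)) =
   (fun c : R => (j.+1`!%:R)^-1 * (c ^+ j.+1 * expR (- c))).
  by apply/funext => d; rewrite mulrAC mulrC.
have dP : is_derive c 1 (fun c : R => c ^+ j.+1) (j.+1%:R * c ^+ j).
  apply: DeriveDef; first exact: exprn_derivable.
  by rewrite exp_derive -![_ *: _]/(_ * _) mulr1.
have H := is_deriveZ (j.+1`!%:R)^-1 (is_deriveM dP dN).
apply: is_derive_eq H _.
rewrite -![_ *: _]/(_ * _).
have : (j.+1%:R : R) != 0 by rewrite pnatr_eq0.
have : (j`!%:R : R) != 0 by rewrite pnatr_eq0 -lt0n fact_gt0.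
rewrite /= factS natrM exprS; move: (j.+1%:R : R) (j`!%:R : R) => u v v0 u0.
by field; rewrite u0 v0.
Qed.

Lemma mehler_weight_bounds (R : realType) (x c : R) k j :
  0 <= x <= 1 -> 0 <= c -> 0 <= mehler_weight x c k j <= 1.
Proof.
move=> /andP[x0 x1] c0; elim: k j => [|k IHk] j /=.
  rewrite /poisson_weight; have := c0; rewrite le_eqVlt => /predU1P[<-|c_gt0].
    by rewrite oppr0 expR0 mulr1; case: j => [|j];
      rewrite ?expr0 ?fact0 ?divr1 ?expr0n /= ?mul0r ?lexx ?ler01.
  rewrite -/(poisson_weight c j) -pmf_Poi// pmf_ge0/= -lee_fin fineK ?fin_num_measure//.
  exact: probability_le1.
have /andP[b0 b1] := IHk j.
have /andP[a0 a1] : 0 <= (if j is j'.+1 then mehler_weight x c k j' else 0) <= 1.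
  by case: j {b0 b1} => [|j]; rewrite ?lexx ?ler01.
move: (if j is _.+1 then _ else _) (mehler_weight x c k j) a0 a1 b0 b1 => a b a0 a1 b0 b1.
by apply/andP; split; nra.
Qed.

Lemma mehler_weight0 (R : realType) k j : mehler_weight (1 : R) 0 k j = (j == k)%:R.
Proof.
elim: k j => [|k IHk] j /=.
  rewrite /poisson_weight oppr0 expR0 mulr1.
  by case: j => [|j]; rewrite ?expr0 ?fact0 ?divr1// expr0n mul0r.
by rewrite subrr mul0r addr0 mul1r; case: j.
Qed.

Section mehler.
Context {R : realType} (lam : R).

(** Each of the k initial customers is still there with probability exp (- t),
    and the number of later arrivals still present is an independent Poisson
    variable. *)
Definition mehler_kernel (t : R) (k j : nat) : R :=
  mehler_weight (expR (- t)) ((1 - expR (- t)) * lam) k j.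

Let is_derive_expRN (t : R) :
  is_derive t 1 (fun t : R => expR (- t)) (- expR (- t)).
Proof. by apply: is_derive_eq; rewrite mulrN1. Qed.

(** Induction on k, differentiating the formula that conditions on one initial
    customer. *)
Lemma is_derive_mehler_kernel (t : R) k j :
  is_derive t 1 (fun t => mehler_kernel t k j)
    (generator lam (fun i => mehler_kernel t i j) k).
Proof.
have dx := is_derive_expRN t; set x := expR (- t).
elim: k j => [|k IHk] j.
  have dc : is_derive t 1 (fun t : R => (1 - expR (- t)) * lam) (x * lam).
    by apply: is_derive_eq; rewrite -![_ *: _]/(_ * _) -/x; ring.
  have := @is_derive1_comp R (poisson_weight ^~ j) (fun t => (1 - expR (- t)) * lam) t _ _
    (is_derive_poisson_weight _ j) dc.
  move=> H; apply: is_derive_eq H _.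
  rewrite /generator mul0r addr0 /mehler_kernel /= -/x.
  by case: j => [|j]; ring.
pose Qm (t : R) i := if j is j'.+1 then mehler_kernel t i j' else 0.
have dQm : is_derive t 1 (fun t => Qm t k) (generator lam (Qm t) k).
  rewrite /Qm; case: (j) => [|j']; last exact: IHk.
  by apply: is_derive_eq; rewrite /generator !subrr !mulr0 addr0.
have dQ := IHk j.
have QE (s : R) i : mehler_kernel s i.+1 j =
  expR (- s) * Qm s i + (1 - expR (- s)) * mehler_kernel s i j.
  by rewrite /mehler_kernel /= /Qm; case: (j).
have -> : (fun s => mehler_kernel s k.+1 j) =
    (fun s => expR (- s) * Qm s k + (1 - expR (- s)) * mehler_kernel s k j).
  by apply/funext => s; exact: QE.
apply: is_derive_eq; rewrite -![_ *: _]/(_ * _) -/x.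
rewrite /generator /= !QE -/x.
case: k {IHk dQm dQ} => [|k] /=; first by ring.
by rewrite !QE -/x -!natr1; ring.
Qed.

End mehler.

Lemma rate_sum (R : realType) (lam : R) (v : nat -> R) k :
  \sum_(i < k.+2) qqinf_rate lam k i * v i = generator lam v k.
Proof.
rewrite !big_ord_recr/= /generator.
have -> : qqinf_rate lam k k.+1 = lam by rewrite /qqinf_rate eqxx.
have -> : qqinf_rate lam k k = - (k%:R + lam).
  by rewrite /qqinf_rate eqxx; case: eqP => [?|_]; first by lia.
case: k => [|k].
  by rewrite big_ord0; ring.
rewrite big_ord_recr/= big1 ?add0r; last first.
  move=> i _; have ik := ltn_ord i.
  rewrite /qqinf_rate; do 3 (case: eqP => [?|_]; first by lia).
  by rewrite mul0r.
have -> : qqinf_rate lam k.+1 k = k.+1%:R.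
  by rewrite /qqinf_rate eqxx; case: eqP => [?|_]; first by lia.
by ring.
Qed.

Section transition_function.
Context {R : realType} (lam : R) (P : R -> nat -> probability nat R).
Hypotheses (lam0 : 0 < lam) (PQ : qqinf_transition lam P).

Lemma pmf_le1 (nu : probability nat R) j : pmf nu j <= 1.
Proof. by rewrite -lee_fin fineK ?fin_num_measure//; exact: probability_le1. Qed.

Lemma chapman_kolmogorov_real (s t : R) k (A : set nat) : 0 <= s -> 0 <= t ->
  fine (P (s + t) k A) = \int[P s k]_i fine (P t i A).
Proof.
move=> s0 t0; rewrite (qqinf_chapman_kolmogorov PQ)//.
by congr fine; apply: eq_integral => i _; rewrite fineK// fin_num_measure.
Qed.

Let pp t k j := pmf (P t k) j.

Let pp0 k j : pp 0 k j = (j == k)%:R.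
Proof.
rewrite /pp /pmf (qqinf_start PQ) diracE/=.
by congr (nat_of_bool _)%:R; apply/idP/eqP; rewrite inE.
Qed.

Let pp_rate k i :
  (pp h k i - (i == k)%:R) / h @[h --> 0^'+] --> qqinf_rate lam k i.
Proof. exact: (qqinf_rates PQ). Qed.

Let pp_cvg0 k i : pp h k i - (i == k)%:R @[h --> 0^'+] --> (0 : R).
Proof.
have : pp (0 + h) k i @[h --> 0^'+] --> pp 0 k i.
  apply: (@right_derivative_cvg R (fun h => pp h k i) 0 (qqinf_rate lam k i)).
  by rewrite pp0; under eq_fun do rewrite add0r; exact: pp_rate.
under eq_fun do rewrite add0r.
rewrite pp0 => H.
have : pp h k i - (i == k)%:R @[h --> 0^'+] --> ((i == k)%:R - (i == k)%:R : R).
  by apply: cvgB => //; exact: cvg_cst.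
by rewrite subrr.
Qed.

Let sum_delta k (v : nat -> R) :
  \sum_(i < k.+2) ((i : nat) == k)%:R * v i = v k.
Proof.
have := sum_indic k k.+2 v; rewrite ltnS leqnSn => <-.
by apply: eq_bigr => i _; rewrite mulrC eq_sym.
Qed.

(** The Chapman-Kolmogorov equation, truncated to the states that can be reached
    from k in at most one jump. *)
Let pp_step (h t : R) k j : 0 <= h -> 0 <= t ->
  `|pp (h + t) k j - \sum_(i < k.+2) pp h k i * pp t i j| <=
  1 - \sum_(i < k.+2) pp h k i.
Proof.
move=> h0 t0; rewrite /pp {1}/pmf chapman_kolmogorov_real//.
have := @expect_tail R _ (integral_expectation (P h k)) k.+2 1
  (fun i => pmf (P t i) j).
under eq_bigr do rewrite integral_point mulrC.
under [X in _ -> _ <= _ * (_ - X)]eq_bigr do rewrite integral_point.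
by rewrite mul1r; apply=> i; rewrite ger0_norm ?pmf_le1 ?pmf_ge0.
Qed.

(** The rates out of k add up to 0, hence more than one jump within time h has
    probability o(h). *)
Let defect k :
  (1 - \sum_(i < k.+2) pp h k i) / h @[h --> 0^'+] --> (0 : R).
Proof.
have -> : (fun h => (1 - \sum_(i < k.+2) pp h k i) / h) =
    (fun h => - \sum_(i < k.+2) (pp h k i - ((i : nat) == k)%:R) / h).
  have d1 : \sum_(i < k.+2) ((i : nat) == k)%:R = 1 :> R.
    by rewrite -[RHS](sum_delta k (fun=> 1)); apply: eq_bigr => i _; rewrite mulr1.
  by apply/funext => h; rewrite -mulr_suml sumrB d1 -mulNr opprB.
rewrite -[X in _ --> X]oppr0; apply: cvgN.
have rate0 : \sum_(i < k.+2) qqinf_rate lam k i = 0.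
  transitivity (\sum_(i < k.+2) qqinf_rate lam k i * 1).
    by apply: eq_bigr => i _; rewrite mulr1.
  by rewrite (rate_sum lam (fun=> 1)) /generator !subrr !mulr0 addr0.
rewrite -[X in _ --> X]rate0.
exact: (@cvg_fin_sum R R (0^'+) _ k.+2
  (fun h i => (pp h k i - (i == k)%:R) / h) (qqinf_rate lam k) (@pp_rate k)).
Qed.

Let pp_right_derivative (t : R) k j : 0 <= t ->
  (pp (t + h) k j - pp t k j) / h @[h --> 0^'+] -->
  generator lam (fun i => pp t i j) k.
Proof.
move=> t0; pose S h := \sum_(i < k.+2) (pp h k i - ((i : nat) == k)%:R) / h * pp t i j.
have ST : S h @[h --> 0^'+] --> generator lam (fun i => pp t i j) k.
  rewrite -rate_sum.
  apply: (@cvg_fin_sum R R (0^'+) _ k.+2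
    (fun h i => (pp h k i - (i == k)%:R) / h * pp t i j)
    (fun i => qqinf_rate lam k i * pp t i j)) => i.
  by apply: cvgMl; exact: pp_rate.
rewrite -[X in _ --> X]addr0.
have : S h + ((pp (t + h) k j - pp t k j) / h - S h) @[h --> 0^'+] -->
   generator lam (fun i => pp t i j) k + 0.
  apply: cvgD => //.
  apply: (@squeeze_cvgr _ _ _ _
    (fun h => - ((1 - \sum_(i < k.+2) pp h k i) / h))
    (fun h => (1 - \sum_(i < k.+2) pp h k i) / h)).
  - near=> h.
    have h0 : 0 < h by near: h; exact: nbhs_right_gt.
    have -> : (pp (t + h) k j - pp t k j) / h - S h =
       (pp (h + t) k j - \sum_(i < k.+2) pp h k i * pp t i j) / h.
      rewrite /S; under eq_bigr do rewrite mulrAC mulrBl.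
      rewrite -mulr_suml sumrB (sum_delta k (fun i => pp t i j)) (addrC t h); ring.
    rewrite -mulNr !ler_pM2r ?invr_gt0// -ler_norml.
    by apply: pp_step => //; exact: ltW.
  - by rewrite -[X in _ --> X]oppr0; apply: cvgN; exact: defect.
  - exact: defect.
apply: cvg_trans; apply: near_eq_cvg; near=> h.
by rewrite subrKC.
Unshelve. all: by end_near. Qed.

Let pp_left_continuous (t : R) k j : 0 < t ->
  pp (t - h) k j @[h --> 0^'+] --> pp t k j.
Proof.
move=> t0.
pose b h := (1 - \sum_(i < k.+2) pp h k i) +
  \sum_(i < k.+2) `|pp h k i - ((i : nat) == k)%:R|.
have b0 : b h @[h --> 0^'+] --> (0 : R).
  rewrite -[X in _ --> X]addr0; apply: cvgD.
    have h0 : h @[h --> (0 : R)^'+] --> (0 : R) by exact: cvg_at_right_filter.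
    have : (1 - \sum_(i < k.+2) pp h k i) / h * h @[h --> 0^'+] --> (0 : R) * 0.
      by apply: cvgM => //; exact: defect.
    rewrite mulr0; apply: cvg_trans; apply: near_eq_cvg; near=> h.
    by rewrite mulfVK// gt_eqF//; near: h; exact: nbhs_right_gt.
  have norm0 : \sum_(i < k.+2) `|0 : R| = 0.
    by rewrite big1// => i _; rewrite normr0.
  rewrite -[X in _ --> X]norm0.
  apply: (@cvg_fin_sum R R (0^'+) _ k.+2
    (fun h i => `|pp h k i - (i == k)%:R|) (fun=> `|0|)) => i.
  by apply: cvg_norm; exact: pp_cvg0.
apply: (@squeeze_cvgr _ _ _ _ (fun h => pp t k j - b h) (fun h => pp t k j + b h)).
- near=> h.
  have h0 : 0 < h by near: h; exact: nbhs_right_gt.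
  have ht : h <= t by apply/ltW; near: h; exact: nbhs_right_lt.
  rewrite -ler_distlC.
  have th : 0 <= t - h by rewrite subr_ge0.
  have := pp_step k j (ltW h0) th; rewrite subrKC => H.
  have -> : pp t k j - pp (t - h) k j =
    (pp t k j - \sum_(i < k.+2) pp h k i * pp (t - h) i j) +
    \sum_(i < k.+2) (pp h k i - ((i : nat) == k)%:R) * pp (t - h) i j.
    under [X in _ = _ + X]eq_bigr do rewrite mulrBl.
    by rewrite sumrB (sum_delta k (fun i => pp (t - h) i j)); ring.
  apply: (le_trans (ler_normD _ _)); apply: lerD => //.
  apply: (le_trans (ler_norm_sum _ _ _)); apply: ler_sum => i _.
  by rewrite normrM ler_piMr// ger0_norm ?pmf_le1 ?pmf_ge0.
- by rewrite -[X in _ --> X]subr0; apply: cvgB => //; exact: cvg_cst.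
- by rewrite -[X in _ --> X]addr0; apply: cvgD => //; exact: cvg_cst.
Unshelve. all: by end_near. Qed.

(** The two sides solve the backward equation with the same initial value, so
    the maximum principle applies to their difference and to its opposite. *)
Lemma transition_mehler (t : R) k j : 0 <= t ->
  pmf (P t k) j = mehler_kernel lam t k j.
Proof.
move=> t0.
have mehler0 i : mehler_kernel lam 0 i j = (j == i)%:R.
  by rewrite /mehler_kernel oppr0 expR0 subrr mul0r mehler_weight0.
have mehler_b (s : R) i : 0 <= s -> 0 <= mehler_kernel lam s i j <= 1.
  move=> s0; have e1 : expR (- s) <= 1 by rewrite expR_le1 oppr_le0.
  by apply: mehler_weight_bounds; rewrite ?expR_ge0// mulr_ge0 ?subr_ge0// ltW.
have mehler_left (s : R) i :
    mehler_kernel lam (s - h) i j @[h --> 0^'+] --> mehler_kernel lam s i j.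
  have cM : {for s, continuous (fun s => mehler_kernel lam s i j)}.
    have ? := is_derive_mehler_kernel lam s i j.
    by apply/differentiable_continuous/derivable1_diffP/ex_derive.
  apply: (@cvg_comp _ _ _ (fun h => s - h) (fun s => mehler_kernel lam s i j)
    (0^'+) (nbhs s)) => //.
  apply: cvg_at_right_filter; rewrite -[X in _ --> X]subr0.
  by apply: cvgB; [exact: cvg_cst|exact: cvg_id].
apply/eqP; rewrite eq_le -subr_le0 -[X in _ && X]subr_le0.
apply/andP; split.
- apply: (@maximum_principle R lam 1
    (fun t k => pp t k j - mehler_kernel lam t k j)) => //.
  + by move=> i; rewrite pp0 mehler0 subrr.
  + move=> s i s0; have /andP[m0 _] := mehler_b s i s0.
    by have := pmf_le1 (P s i) j; rewrite -/(pp s i j); lra.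
  + move=> s i s0.
    have -> : (fun h => (pp (s + h) i j - mehler_kernel lam (s + h) i j -
        (pp s i j - mehler_kernel lam s i j)) / h) =
      (fun h => (pp (s + h) i j - pp s i j) / h -
         (mehler_kernel lam (s + h) i j - mehler_kernel lam s i j) / h).
      by apply/funext => h; ring.
    have -> : generator lam (fun i => pp s i j - mehler_kernel lam s i j) i =
       generator lam (fun i => pp s i j) i -
       generator lam (fun i => mehler_kernel lam s i j) i.
      by rewrite /generator; ring.
    apply: cvgB; first exact: pp_right_derivative.
    exact: (is_derive_right (is_derive_mehler_kernel lam s i j)).
  + by move=> s i s0; apply: cvgB; [exact: pp_left_continuous|exact: mehler_left].
- apply: (@maximum_principle R lam 1
    (fun t k => mehler_kernel lam t k j - pp t k j)) => //.
  + by move=> i; rewrite pp0 mehler0 subrr.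
  + move=> s i s0; have /andP[_ m1] := mehler_b s i s0.
    by have := pmf_ge0 (P s i) j; rewrite -/(pp s i j); lra.
  + move=> s i s0.
    have -> : (fun h => (mehler_kernel lam (s + h) i j - pp (s + h) i j -
        (mehler_kernel lam s i j - pp s i j)) / h) =
      (fun h => (mehler_kernel lam (s + h) i j - mehler_kernel lam s i j) / h -
         (pp (s + h) i j - pp s i j) / h).
      by apply/funext => h; ring.
    have -> : generator lam (fun i => mehler_kernel lam s i j - pp s i j) i =
       generator lam (fun i => mehler_kernel lam s i j) i - generator lam (fun i => pp s i j) i.
      by rewrite /generator; ring.
    apply: cvgB; last exact: pp_right_derivative.
    exact: (is_derive_right (is_derive_mehler_kernel lam s i j)).
  + by move=> s i s0; apply: cvgB; [exact: mehler_left|exact: pp_left_continuous].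
Qed.

End transition_function.

(** * Reverse hypercontractivity away from zero *)

Lemma cvg_powR (R : realType) (s y : R) (u : nat -> R) : 0 < y ->
  u n @[n --> \oo] --> y -> (u n) `^ s @[n --> \oo] --> (y `^ s : R).
Proof.
move=> y0 uy.
apply: (@cvg_comp _ _ _ u (fun z : R => z `^ s) _ (nbhs y) (nbhs (y `^ s)) uy).
have d1 := is_derive1_powR s y0.
suff : {for y, continuous (fun z : R => z `^ s)} by [].
by apply/differentiable_continuous/derivable1_diffP/ex_derive.
Qed.

Section poisson_inequalities.
Context {R : realType} (lam : R) (P : R -> nat -> probability nat R).
Hypotheses (lam0 : 0 < lam) (PQ : qqinf_transition lam P).

Local Notation E := (Rintegral (Poi lam) setT).
Local Notation T := (semigroup P).

Let EE : expectation E. Proof. exact: integral_expectation. Qed.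

Let lamK : lam < (Num.bound lam).+1%:R.
Proof.
by rewrite (lt_trans (archi_boundP (ltW lam0)))// ltr_nat.
Qed.

Local Notation al n := (lam / (n + (Num.bound lam).+1)%:R).

Let al01 n : 0 <= (al n : R) <= 1.
Proof.
have m0 : (0 : R) < (n + (Num.bound lam).+1)%:R by rewrite ltr0n addnS.
rewrite divr_ge0 ?(ltW lam0)//= ler_pdivrMr// mul1r ltW//.
by rewrite (lt_le_trans lamK)// ler_nat leq_addl.
Qed.

Let expRN_ge0 (t : R) : 0 <= expR (- t). Proof. exact: expR_ge0. Qed.

Let expRN_le1 (t : R) : 0 <= t -> expR (- t) <= 1.
Proof. by move=> t0; rewrite expR_le1 oppr_le0. Qed.

Lemma correlated_mean_semigroup_limit (t : R) (f g : nat -> R) : 0 <= t ->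
  bdd f -> bdd g ->
  correlated_mean (al n) (expR (- t)) (n + (Num.bound lam).+1) f g @[n --> \oo] -->
  E (fun k => f k * T t g k).
Proof.
move=> t0 fb gb.
apply: (@correlated_mean_limit R lam (expR (- t)) (Num.bound lam) lam0 lamK
  (expRN_ge0 t) (expRN_le1 t0) (P t) f g) => // k j.
exact: transition_mehler.
Qed.

Lemma bdd_semigroup (t lo hi : R) (g : nat -> R) :
  (forall k, lo <= g k <= hi) -> forall k, lo <= T t g k <= hi.
Proof. by move=> gb k; apply: expect_bounds => //; exact: integral_expectation. Qed.

(** Reversibility, inherited from [correlated_mean_sym] in the limit. *)
Lemma semigroup_symmetric (t : R) (f g : nat -> R) : 0 <= t ->
  bdd f -> bdd g -> E (fun k => f k * T t g k) = E (fun k => g k * T t f k).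
Proof.
move=> t0 fb gb; have := correlated_mean_semigroup_limit t0 fb gb.
under eq_fun do rewrite correlated_mean_sym//.
move=> H; apply: (cvg_unique _ H); [exact: Rhausdorff|].
exact: correlated_mean_semigroup_limit.
Qed.

Lemma powR_between (s lo hi y : R) : 0 < lo -> lo <= y <= hi ->
  0 < y /\
  Num.min (lo `^ s) (hi `^ s) <= y `^ s <= Num.max (lo `^ s) (hi `^ s).
Proof.
move=> lo0 /andP[ly yh]; have y0 := lt_le_trans lo0 ly.
have hi0 := lt_le_trans y0 yh; split=> //.
have mono a b : 0 < a -> a <= b ->
    (0 <= s -> a `^ s <= b `^ s) /\ (s <= 0 -> b `^ s <= a `^ s).
  move=> a0 ab; have b0 := lt_le_trans a0 ab.
  split=> s0; rewrite /powR !gt_eqF// ler_expR.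
    by rewrite ler_wpM2l// ler_ln.
  by rewrite ler_wnM2l// ler_ln.
rewrite ge_min le_max.
have [s0|/ltW s0] := leP 0 s.
  by rewrite (mono _ _ lo0 ly).1// (mono _ _ y0 yh).1// orbT.
by rewrite (mono _ _ lo0 ly).2// (mono _ _ y0 yh).2// orbT.
Qed.

Lemma bdd_powR (s lo hi : R) (h : nat -> R) : 0 < lo ->
  (forall k, lo <= h k <= hi) -> bdd (fun k => h k `^ s).
Proof.
move=> lo0 hb.
by apply: bdd_between => k; exact: (powR_between s lo0 (hb k)).2.
Qed.

Lemma expect_powR_gt0 (s lo hi : R) (h : nat -> R) : 0 < lo ->
  (forall k, lo <= h k <= hi) -> 0 < E (fun k => h k `^ s).
Proof.
move=> lo0 hb.
have /andP[+ _] := expect_bounds EE (fun k => (powR_between s lo0 (hb k)).2).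
apply: lt_le_trans.
have hi0 : 0 < hi by have /andP[h1 h2] := hb 0%N; lra.
by rewrite lt_min !powR_gt0.
Qed.

Lemma two_function_inequality (t lo hi p q : R) (f g : nat -> R) :
  0 <= t -> 0 < q -> q < p -> p < 1 ->
  expR (- t) <= (1 - p) * (2 - q) / ((1 - q) * (2 - p)) ->
  0 < lo -> (forall k, lo <= f k <= hi) -> (forall k, lo <= g k <= hi) ->
  E (fun k => f k `^ dual_exponent q) `^ (dual_exponent q)^-1 *
  E (fun k => g k `^ p) `^ p^-1 <= E (fun k => f k * T t g k).
Proof.
move=> t0 q0 qp p1 xt lo0 fb gb.
have norm_cvg s (h : nat -> R) : (forall k, lo <= h k <= hi) ->
    binomial_mean (al n) (n + (Num.bound lam).+1) (fun k => h k `^ s) `^ s^-1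
      @[n --> \oo] --> E (fun k => h k `^ s) `^ s^-1.
  move=> hb; have y0 := expect_powR_gt0 s lo0 hb.
  by apply: cvg_powR => //; exact: (binomial_mean_limit lam0 lamK (bdd_powR s lo0 hb)).
have lim := correlated_mean_semigroup_limit t0 (bdd_between fb) (bdd_between gb).
apply: (ler_cvg_to (cvgM (norm_cvg (dual_exponent q) _ fb) (norm_cvg p _ gb)) lim).
apply: nearW => n; apply: correlated_mean_lower_bound => //; first exact: expR_gt0.
- by move=> k; have /andP[+ _] := fb k; exact: lt_le_trans.
- by move=> k; have /andP[+ _] := gb k; exact: lt_le_trans.
Qed.

(** For f = (T g) ^ (q - 1), both f ^ (dual_exponent q) and f * T g are equal to
    (T g) ^ q. *)
Lemma hypercontractive_pos (t lo hi p q : R) (g : nat -> R) :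
  0 <= t -> 0 < q -> q < p -> p < 1 ->
  expR (- t) <= (1 - p) * (2 - q) / ((1 - q) * (2 - p)) ->
  0 < lo -> (forall k, lo <= g k <= hi) ->
  E (fun k => g k `^ p) `^ p^-1 <= E (fun k => T t g k `^ q) `^ q^-1.
Proof.
move=> t0 q0 qp p1 xt lo0 gb; have q1 := lt_trans qp p1.
have Tb := bdd_semigroup t gb.
have hi0 : 0 < hi by have /andP[h1 h2] := gb 0%N; lra.
pose s := q - 1.
pose f k := T t g k `^ s.
pose m := Num.min lo (Num.min (lo `^ s) (hi `^ s)).
pose M := Num.max hi (Num.max (lo `^ s) (hi `^ s)).
have m0 : 0 < m by rewrite !lt_min lo0 !powR_gt0.
have fb k : m <= f k <= M.
  have /andP[h1 h2] := (powR_between s lo0 (Tb k)).2.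
  by rewrite ge_min le_max h1 h2 !orbT.
have gb' k : m <= g k <= M.
  by have /andP[h1 h2] := gb k; rewrite ge_min le_max h1 h2.
have := two_function_inequality t0 q0 qp p1 xt m0 fb gb'.
have Tpos k : 0 < T t g k by have /andP[+ _] := Tb k; exact: lt_le_trans.
have -> : (fun k => f k `^ dual_exponent q) = (fun k => T t g k `^ q).
  apply/funext => k; rewrite /f -powRrM /dual_exponent /s; congr (_ `^ _).
  by field; rewrite subr_eq0 gt_eqF.
have -> : (fun k => f k * T t g k) = (fun k => T t g k `^ q).
  by apply/funext => k; rewrite /f mulrC mulr_powRB1// ltW.
have := expect_powR_gt0 q lo0 Tb.
move: (E (fun k => T t g k `^ q)) (E (fun k => g k `^ p) `^ p^-1) => A G A0 H.
have : A `^ (dual_exponent q)^-1 * G <= A `^ (dual_exponent q)^-1 * A `^ q^-1.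
  have AN : A != 0 by rewrite gt_eqF.
  rewrite -powRD ?AN ?implybT//.
  have -> : (dual_exponent q)^-1 + q^-1 = 1.
    rewrite /dual_exponent; field.
    by rewrite subr_eq0 !gt_eqF.
  by rewrite powRr1// ltW.
by rewrite ler_pM2l// powR_gt0.
Qed.

End poisson_inequalities.

Lemma le_ln (R : realType) (a b : R) : 0 < a -> a <= b -> ln a <= ln b.
Proof. by move=> a0 ab; rewrite ler_ln ?posrE// (lt_le_trans a0). Qed.

(** * Exponent zero, and functions with zeros *)

Lemma expR_quadratic (R : realType) (s : R) : s <= 1 / 2 ->
  expR s <= 1 + s + 2 * s ^+ 2.
Proof.
move=> s2; have s1 : 0 < 1 - s by lra.
have : (1 - s) * expR s <= 1.
  rewrite -[leRHS](expRxMexpNx_1 s) mulrC ler_pM2l ?expR_gt0//.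
  exact: expR_ge1Dx.
rewrite -ler_pdivlMl// => /le_trans; apply.
rewrite mulr1 -[leLHS]mul1r ler_pdivrMr//.
have : 0 <= s ^+ 2 * (1 - 2 * s) by rewrite mulr_ge0 ?sqr_ge0//; lra.
by rewrite expr2; lra.
Qed.

Lemma ln_between (R : realType) (lo hi y : R) : 0 < lo -> lo <= y <= hi ->
  ln lo <= ln y <= ln hi.
Proof.
move=> lo0 /andP[ly yh]; have y0 := lt_le_trans lo0 ly.
by rewrite !ler_ln ?posrE ?ly// (lt_le_trans y0).
Qed.

Lemma le_powR (R : realType) (s a b : R) : 0 <= s -> 0 <= a -> a <= b ->
  a `^ s <= b `^ s.
Proof.
by move=> s0 a0 ab; apply: ge0_ler_powR; rewrite ?nnegrE//; exact: le_trans ab.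
Qed.

Lemma powR_invK (R : realType) (s a : R) : s != 0 -> 0 <= a ->
  (a `^ s^-1) `^ s = a.
Proof. by move=> s0 a0; rewrite -powRrM mulVf// powRr1. Qed.

Section log_inequalities.
Context {R : realType} (lam : R) (P : R -> nat -> probability nat R).
Hypotheses (lam0 : 0 < lam) (PQ : qqinf_transition lam P).

Local Notation E := (Rintegral (Poi lam) setT).
Local Notation T := (semigroup P).

Let EE : expectation E. Proof. exact: integral_expectation. Qed.

(** Let q tend to 0 in [hypercontractive_pos], using that (y ^ q - 1) / q exceeds
    ln y by at most 2 L ^ 2 q when |ln y| <= L and q L <= 1 / 2. *)
Lemma log_hypercontractive (t lo hi p : R) (g : nat -> R) :
  0 <= t -> 0 < p -> p < 1 ->
  expR (- t) <= 2 * (1 - p) / (2 - p) ->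
  0 < lo -> (forall k, lo <= g k <= hi) ->
  ln (E (fun k => g k `^ p) `^ p^-1) <= E (fun k => ln (T t g k)).
Proof.
move=> t0 p0 p1 xt lo0 gb; apply/ler_addgt0Pr => e e0.
have Tb := bdd_semigroup P t gb.
have Tpos k : 0 < T t g k by have /andP[+ _] := Tb k; exact: lt_le_trans.
pose L := `|ln lo| + `|ln hi| + 1.
have L1 : 1 <= L by rewrite lerDr addr_ge0.
have L0 : 0 < L by exact: lt_le_trans L1.
have lnT k : - L <= ln (T t g k) <= L.
  have /andP[h1 h2] := ln_between lo0 (Tb k).
  have := ler_norm (ln hi); have := ler_norm (- ln lo); rewrite normrN.
  have := normr_ge0 (ln hi); have := normr_ge0 (ln lo).
  by rewrite /L => *; apply/andP; split; lra.
have lnb : bdd (fun k => ln (T t g k)) by exact: bdd_between lnT.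
(* below p, with q L <= 1 / 2, and with an error 2 L ^ 2 q of at most e *)
pose q := Num.min (p / 2) (Num.min (1 / (2 * L)) (e / (2 * L ^+ 2))).
have LL0 : 0 < 2 * L ^+ 2 by rewrite mulr_gt0 ?exprn_gt0.
have q0 : 0 < q.
  by rewrite !lt_min !divr_gt0// mulr_gt0.
have qp : q < p.
  by rewrite gt_min ltr_pdivrMr// ltr_pMr// ltr1n.
have qL : q * L <= 1 / 2.
  have : q <= 1 / (2 * L) by rewrite !ge_min lexx !orbT.
  move=> /(ler_wpM2r (ltW L0)) /le_trans; apply.
  by rewrite le_eqVlt; apply/orP; left; apply/eqP; field; rewrite gt_eqF.
have qe : q * (2 * L ^+ 2) <= e.
  by rewrite -ler_pdivlMr// !ge_min lexx !orbT.
clearbody q; clear LL0.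
have q1 := lt_trans qp p1.
have xq : expR (- t) <= (1 - p) * (2 - q) / ((1 - q) * (2 - p)).
  apply: (le_trans xt); rewrite ler_pdivrMr; last by lra.
  rewrite mulrAC ler_pdivlMr; last by rewrite mulr_gt0//; lra.
  rewrite (_ : 2 * (1 - p) * ((1 - q) * (2 - p)) =
    (1 - p) * (2 - p) * (2 * (1 - q))); last by ring.
  rewrite (_ : (1 - p) * (2 - q) * (2 - p) =
    (1 - p) * (2 - p) * (2 - q)); last by ring.
  by rewrite ler_wpM2l ?mulr_ge0//; lra.
have H := hypercontractive_pos lam0 PQ t0 q0 qp p1 xq lo0 gb.
have A0 := expect_powR_gt0 lam q lo0 Tb.
have G0 := expect_powR_gt0 lam p lo0 gb.
apply: (@le_trans _ _ (ln (E (fun k => T t g k `^ q) `^ q^-1))).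
  exact: (le_ln (powR_gt0 p^-1 G0) H).
rewrite ln_powR mulrC ler_pdivrMr//.
have A1 : E (fun k => T t g k `^ q) <=
    1 + q * E (fun k => ln (T t g k)) + q * (q * (2 * L ^+ 2)).
  have -> : 1 + q * E (fun k => ln (T t g k)) + q * (q * (2 * L ^+ 2)) =
      E (fun k => (1 + q * (q * (2 * L ^+ 2))) + q * ln (T t g k)).
    rewrite (expectD EE); [|exact: bdd_cst|exact: bddZ].
    by rewrite (expect_cst EE) (expectZ EE)//; ring.
  apply: (expect_le EE); first exact: bdd_powR lo0 Tb.
    by apply: bddD; [exact: bdd_cst|exact: bddZ].
  move=> k; rewrite /powR gt_eqF//; have /andP[h1 h2] := lnT k.
  have : expR (q * ln (T t g k)) <=
      1 + q * ln (T t g k) + 2 * (q * ln (T t g k)) ^+ 2.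
    apply: expR_quadratic; apply: le_trans qL.
    by rewrite ler_wpM2l// ltW.
  move=> /le_trans; apply.
  have : (ln (T t g k)) ^+ 2 <= L ^+ 2.
    by rewrite -[leLHS]real_normK ?num_real// lerXn2r ?nnegrE ?(ltW L0)// ler_norml h1.
  move=> /(ler_wpM2l (sqr_ge0 q)) h3.
  have -> : 1 + q * (q * (2 * L ^+ 2)) + q * ln (T t g k) =
    1 + q * ln (T t g k) + 2 * (q ^+ 2 * L ^+ 2) by ring.
  by rewrite exprMn lerD2l ler_pM2l.
have := @le_ln1Dx R (E (fun k => T t g k `^ q) - 1).
rewrite subrKC ltrBrDl subrr => /(_ A0) /le_trans; apply.
have := ler_wpM2l (ltW q0) qe.
move: A1; move: (E (fun k => T t g k `^ q)) (E (fun k => ln (T t g k))) => A B.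
by move: (q * (q * (2 * L ^+ 2))) => C A1 qe'; clear - A1 qe'; lra.
Qed.

Lemma powR_subadditive (u v s : R) : 0 <= u -> 0 < v -> 0 < s -> s <= 1 ->
  (u + v) `^ s <= u `^ s + v `^ s.
Proof.
move=> u0 v0 s0 s1; have uv0 : 0 < u + v by rewrite ltr_wpDl.
have frac w : 0 <= w -> w <= u + v -> w / (u + v) <= (w / (u + v)) `^ s.
  rewrite le_eqVlt => /predU1P[<-|w0] wu.
    by rewrite mul0r powR_ge0.
  by rewrite ger1_powR// divr_gt0//= ler_pdivrMr// mul1r.
have uE : u `^ s = (u + v) `^ s * (u / (u + v)) `^ s.
  rewrite -powRM ?(ltW uv0) ?divr_ge0 ?(ltW uv0)//.
  by rewrite mulrCA divff ?mulr1// gt_eqF.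
have vE : v `^ s = (u + v) `^ s * (v / (u + v)) `^ s.
  rewrite -powRM ?(ltW uv0) ?divr_ge0 ?(ltW uv0) ?(ltW v0)//.
  by rewrite mulrCA divff ?mulr1// gt_eqF.
rewrite [u `^ s]uE [v `^ s]vE -mulrDr -[leLHS]mulr1 ler_wpM2l ?powR_ge0//.
have h1 := frac _ u0 ltac:(by rewrite lerDl ltW).
have h2 := frac _ (ltW v0) ltac:(by rewrite lerDr).
apply: le_trans (lerD h1 h2).
by rewrite -mulrDl divff// gt_eqF.
Qed.

Lemma semigroup_shift (t e M : R) (f : nat -> R) k :
  (forall k, 0 <= f k <= M) ->
  T t (fun j => f j + e) k = T t f k + e.
Proof.
move=> fb; have TE := integral_expectation (P t k).
transitivity (\int[P t k]_j f j + \int[P t k]_j e).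
  exact: (expectD TE (bdd_between fb) (bdd_cst e)).
by congr (_ + _); exact: (expect_cst TE).
Qed.

Lemma powR_norm_shift_le (e M p : R) (f : nat -> R) :
  0 < e -> 0 < p -> (forall k, 0 <= f k <= M) ->
  E (fun k => f k `^ p) `^ p^-1 <= E (fun k => (f k + e) `^ p) `^ p^-1.
Proof.
move=> e0 p0 fb.
have pb : bdd (fun k => f k `^ p).
  apply: (@bdd_between _ 0 (M `^ p)) => k; have /andP[f0 fM] := fb k.
  by rewrite powR_ge0/= ge0_ler_powR ?nnegrE ?(ltW p0)// (le_trans f0).
have pe : bdd (fun k => (f k + e) `^ p).
  apply: (@bdd_powR _ _ e (M + e)) => // k; have /andP[f0 fM] := fb k.
  by rewrite lerDr f0 lerD2r.
have E0 : 0 <= E (fun k => f k `^ p).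
  by apply: Rintegral_ge0 => k _; exact: powR_ge0.
have le : E (fun k => f k `^ p) <= E (fun k => (f k + e) `^ p).
  apply: (expect_le EE) => // k; have /andP[f0 fM] := fb k.
  by rewrite ge0_ler_powR ?nnegrE ?addr_ge0 ?(ltW p0) ?(ltW e0)// lerDl ltW.
have p'0 : 0 <= p^-1 by rewrite invr_ge0 ltW.
exact: (le_powR p'0 E0 le).
Qed.

(** Apply [hypercontractive_pos] to f + e; as (y + e) ^ q <= y ^ q + e ^ q, the
    error e ^ q can be any positive number. *)
Lemma hypercontractive (t M p q : R) (f : nat -> R) :
  0 <= t -> 0 < q -> q < p -> p < 1 ->
  expR (- t) <= (1 - p) * (2 - q) / ((1 - q) * (2 - p)) ->
  (forall k, 0 <= f k <= M) ->
  E (fun k => f k `^ p) `^ p^-1 <= E (fun k => T t f k `^ q) `^ q^-1.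
Proof.
move=> t0 q0 qp p1 xt fb; have q1 := lt_trans qp p1.
have p0 := lt_trans q0 qp.
have Tb k : 0 <= T t f k <= M.
  by apply: expect_bounds => //; exact: integral_expectation.
set G := E (fun k => f k `^ p) `^ p^-1.
have G0 : 0 <= G by exact: powR_ge0.
have Tq : bdd (fun k => T t f k `^ q).
  apply: (@bdd_between _ 0 (M `^ q)) => k; have /andP[T0 TM] := Tb k.
  by rewrite powR_ge0/= ge0_ler_powR ?nnegrE ?(ltW q0)// (le_trans T0).
have A0 : 0 <= E (fun k => T t f k `^ q).
  by apply: Rintegral_ge0 => k _; exact: powR_ge0.
suff h : G `^ q <= E (fun k => T t f k `^ q).
  have -> : G = (G `^ q) `^ q^-1 by rewrite -powRrM mulfV ?gt_eqF// powRr1.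
  have q'0 : 0 <= q^-1 by rewrite invr_ge0 ltW.
  exact: (le_powR q'0 (powR_ge0 _ _) h).
apply/ler_addgt0Pr => e' e'0.
(* so that e ^ q = e' *)
pose e := e' `^ q^-1.
have e0 : 0 < e by exact: powR_gt0.
have eq : e `^ q = e' by rewrite /e -powRrM mulVf ?gt_eqF// powRr1 ?ltW.
clearbody e.
have feb k : e <= f k + e <= M + e.
  by have /andP[f0 fM] := fb k; rewrite lerDr f0 lerD2r.
have h1 := powR_norm_shift_le e0 p0 fb.
have h2 := hypercontractive_pos lam0 PQ t0 q0 qp p1 xt e0 feb.
have Tsh : T t (fun k => f k + e) = (fun k => T t f k + e).
  by apply/funext => k; exact: semigroup_shift fb.
rewrite Tsh in h2.
have Teb k : e <= T t f k + e <= M + e.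
  by have /andP[f0 fM] := Tb k; rewrite lerDr f0 lerD2r.
have B0 := expect_powR_gt0 lam q e0 Teb.
have h3 : E (fun k => (T t f k + e) `^ q) <= E (fun k => T t f k `^ q) + e'.
  have <- : E (fun k => T t f k `^ q + e') = E (fun k => T t f k `^ q) + e'.
    transitivity (E (fun k => T t f k `^ q) + E (fun=> e')).
      exact: (expectD EE Tq (bdd_cst e')).
    by congr (_ + _); exact: (expect_cst EE).
  apply: (expect_le EE); first exact: bdd_powR e0 Teb.
    by apply: bddD => //; exact: bdd_cst.
  move=> k; rewrite -eq; have /andP[Tk0 _] := Tb k.
  by apply: powR_subadditive => //; exact: ltW.
apply: le_trans h3; have h4 := le_trans h1 h2.
apply: (le_trans (le_powR (ltW q0) G0 h4)).
have qN : q != 0 by rewrite gt_eqF.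
by rewrite (powR_invK qN (ltW B0)).
Qed.

End log_inequalities.

(** * The norms of the statement *)

Lemma Lp_pos (R : realType) (nu : probability nat R) (p M : R) (f : nat -> R) :
  0 < p -> (forall k, 0 <= f k <= M) ->
  Lp nu p f = ((\int[nu]_k f k `^ p) `^ p^-1)%:E.
Proof.
move=> p0 fb; rewrite /Lp gt_eqF// unlock /Lnorm -poweR_EFin; congr (_ `^ _)%E.
have pb : bdd (fun k => f k `^ p).
  apply: (@bdd_between _ 0 (M `^ p)) => k; have /andP[f0 fM] := fb k.
  by rewrite powR_ge0/= le_powR// ltW.
rewrite /Rintegral fineK; last first.
  by apply: integrable_fin_num => //; exact: (bdd_integrable nu setT pb).
apply: eq_integral => k _ /=; have /andP[f0 _] := fb k.
by rewrite ger0_norm.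
Qed.

Section geometric_mean.
Context {R : realType} (nu : probability nat R).

(** Monotone convergence along e = 1 / (n + 1), for the nonnegative functions
    C - ln (h + e) with C = ln (M + 1). *)
Lemma geometric_mean_ge (a M : R) (h : nat -> R) : 0 < a ->
  (forall k, 0 <= h k <= M) ->
  (forall e, 0 < e -> ln a <= \int[nu]_k ln (h k + e)) ->
  (a%:E <= expeR (\int[nu]_k lne (h k)%:E))%E.
Proof.
move=> a0 hb ha.
have M0 : 0 <= M by have /andP[h1 h2] := hb 0%N; lra.
pose C := ln (M + 1).
pose e n : R := n.+1%:R^-1.
have e0 n : 0 < e n by rewrite invr_gt0.
have e1 n : e n <= 1 by rewrite invf_le1// ler1n.
have hep n k : 0 < h k + e n.
  by have /andP[h1 h2] := hb k; rewrite ltr_wpDl.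
pose g n k : \bar R := (C - ln (h k + e n))%:E.
pose g0 k : \bar R := (C%:E - lne (h k)%:E)%E.
have g_ge0 n k : (0 <= g n k)%E.
  rewrite lee_fin subr_ge0 le_ln//; have /andP[h1 h2] := hb k.
  by rewrite lerD.
have g_ndecr k : {homo g^~ k : n m / (n <= m)%N >-> (n <= m)%E}.
  move=> m n mn; rewrite lee_fin lerD2l lerN2 le_ln// lerD2l.
  by rewrite lef_pV2 ?posrE// ler_nat.
have g_cvg k : g n k @[n --> \oo] --> g0 k.
  rewrite /g /g0; have /andP[] := hb k; rewrite le_eqVlt => /predU1P[<-|hk] _.
    have -> : (C%:E - lne 0%:E = +oo)%E by rewrite le0_lneNy.
    apply/cvgeryP/cvgryPge => B; pose K := Num.bound (expR (B - C)).
    near=> n.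
    rewrite add0r /e lnV ?posrE// opprK -lerBlDl -[leLHS]expRK le_ln ?expR_gt0//.
    apply: ltW; apply: (lt_le_trans (archi_boundP (expR_ge0 (B - C)))).
    by rewrite ler_nat; apply: leqW; near: n; exact: nbhs_infty_ge.
  rewrite lne_EFin// -EFinB; apply: cvg_EFin; first by near=> n.
  apply: cvgB; first exact: cvg_cst.
  apply: (@cvg_comp _ _ _ (fun n => h k + e n) (@ln R) _ (nbhs (h k)) (nbhs (ln (h k)))).
    suff : h k + e n @[n --> \oo] --> h k + 0 by rewrite addr0.
    by apply: cvgD; [exact: cvg_cst|exact: cvg_harmonic].
  exact: continuous_ln.
have lnb n : bdd (fun k => ln (h k + e n)).
  apply: (@bdd_between _ (ln (e n)) (ln (M + e n))) => k; apply: ln_between => //.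
  by have /andP[h1 h2] := hb k; rewrite lerDr h1 lerD2r.
have gI n : (\int[nu]_k g n k <= (C - ln a)%:E)%E.
  have nlnb : bdd (fun k => - ln (h k + e n)).
    by have [B HB] := lnb n; exists B => k; rewrite normrN.
  have gB : bdd (fun k => C - ln (h k + e n)) by apply: bddD => //; exact: bdd_cst.
  rewrite -[leLHS]fineK; last first.
    by apply: integrable_fin_num => //; exact: (bdd_integrable nu setT gB).
  rewrite lee_fin -/(Rintegral nu setT (fun k => C - ln (h k + e n))).
  have -> : \int[nu]_k (C - ln (h k + e n)) = C - \int[nu]_k ln (h k + e n).
    rewrite RintegralB//; last exact: (bdd_integrable nu setT (lnb n)).
      by congr (_ - _); exact: (expect_cst (integral_expectation nu)).
    exact: (bdd_integrable nu setT (bdd_cst C)).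
  by rewrite lerD2l lerN2 ha.
have g0I : (\int[nu]_k g0 k <= (C - ln a)%:E)%E.
  have := @cvg_monotone_convergence _ nat R nu setT measurableT g.
  have -> : (\int[nu]_k limn (g ^~ k) = \int[nu]_k g0 k)%E.
    by apply: eq_integral => k _; apply: (cvg_lim _ (g_cvg k)) => //.
  have g_mono k : [set: nat] k -> {homo g ^~ k : n m / (n <= m)%N >-> (n <= m)%E}.
    by move=> _; exact: g_ndecr.
  move=> /(_ _ (fun n k _ => g_ge0 n k) g_mono) H.
  apply: (cvge_to_le (H _)) => //.
  by apply: nearW => n; exact: gI.
have g0_ge0 k : (0 <= g0 k)%E.
  by apply: (cvge_to_ge (g_cvg k)); apply: nearW => n; exact: g_ge0.
have g0_int : nu.-integrable setT g0.
  apply/integrableP; split=> //.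
  under eq_integral do rewrite gee0_abs//.
  by rewrite (le_lt_trans g0I)// ltry.
have lneE k : lne (h k)%:E = (C%:E - g0 k)%E.
  rewrite /g0 /=; case: ifP => // _; rewrite -!EFinB; congr EFin; ring.
have -> : a%:E = expeR (ln a)%:E by rewrite /= lnK.
rewrite lee_expeR; under eq_integral do rewrite lneE.
have -> : (\int[nu]_k (C%:E - g0 k) = C%:E - \int[nu]_k g0 k)%E.
  rewrite integralB//; last exact: (bdd_integrable nu setT (bdd_cst C)).
  congr (_ - _)%E; rewrite integral_cst//.
  by rewrite -[RHS]mule1; congr (_ * _)%E; exact: probability_setT.
have : (ln a)%:E = (C%:E - (C - ln a)%:E)%E by rewrite -EFinB; congr EFin; ring.
by move=> ->; rewrite leeB.
Unshelve. all: by end_near. Qed.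

End geometric_mean.

Section hypercontractivity_statement.
Context {R : realType} (lam : R) (P : R -> nat -> probability nat R).
Hypotheses (lam0 : 0 < lam) (PQ : qqinf_transition lam P).

Lemma reverse_hypercontractivity (f : nat -> R) (p q t : R) :
  (forall k, 0 <= f k) -> (exists M, forall k, f k <= M) ->
  0 <= q -> q < p -> p < 1 ->
  ln (((1 - q) * (2 - p)) / ((1 - p) * (2 - q))) <= t ->
  (Lp (Poi lam) p f <= Lp (Poi lam) q (semigroup P t f))%E.
Proof.
move=> f0 [M fM] q_ge0 qp p1 zt.
have fb k : 0 <= f k <= M by rewrite f0 fM.
have p0 : 0 < p by exact: le_lt_trans qp.
have q1 := lt_trans qp p1.
have z0 : 0 < (1 - q) * (2 - p) by rewrite mulr_gt0//; lra.
have w0 : 0 < (1 - p) * (2 - q) by rewrite mulr_gt0//; lra.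
have z1 : 1 <= ((1 - q) * (2 - p)) / ((1 - p) * (2 - q)).
  by rewrite ler_pdivlMr// mul1r; nra.
have t0 : 0 <= t by apply: le_trans zt; exact: ln_ge0.
have xt : expR (- t) <= (1 - p) * (2 - q) / ((1 - q) * (2 - p)).
  rewrite -[leRHS]lnK ?posrE ?divr_gt0// ler_expR lerNl.
  by rewrite -lnV ?posrE ?divr_gt0// invf_div.
have Tb := bdd_semigroup P t fb.
rewrite (Lp_pos _ p0 fb).
move: q_ge0; rewrite le_eqVlt => /predU1P[q0|q0]; last first.
  rewrite (Lp_pos _ q0 Tb) lee_fin.
  exact: (hypercontractive lam0 PQ t0 q0 qp p1 xt fb).
rewrite -q0 /Lp eqxx.
set a := _ `^ _; have : 0 <= a by exact: powR_ge0.
rewrite le_eqVlt => /predU1P[<-|a0]; first exact: expeR_ge0.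
apply: (geometric_mean_ge a0 Tb) => e e0.
have feb k : e <= f k + e <= M + e by rewrite lerDr f0 lerD2r fM.
have -> : (fun k => ln (semigroup P t f k + e)) =
    (fun k => ln (semigroup P t (fun k => f k + e) k)).
  by apply/funext => k; rewrite (semigroup_shift P t e k fb).
apply: (le_trans (le_ln a0 (powR_norm_shift_le lam e0 p0 fb))).
apply: (log_hypercontractive lam0 PQ t0 p0 p1 _ e0 feb).
by apply: (le_trans xt); rewrite -q0 !subr0 mul1r (mulrC _ 2).
Qed.

End hypercontractivity_statement.

(** * Two sets at two times *)

Section two_sets.
Context {R : realType} (lam : R) (P : R -> nat -> probability nat R).
Hypotheses (lam0 : 0 < lam) (PQ : qqinf_transition lam P).

Local Notation E := (Rintegral (Poi lam) setT).
Local Notation T := (semigroup P).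

Let EE : expectation E. Proof. exact: integral_expectation. Qed.

(** Jensen: ln lies below its tangent at the mean of h. *)
Lemma log_mean_le (lo hi : R) (h : nat -> R) : 0 < lo ->
  (forall k, lo <= h k <= hi) -> E (fun k => ln (h k)) <= ln (E h).
Proof.
move=> lo0 hb; have /andP[X0 _] := expect_bounds EE hb.
have {}X0 : 0 < E h := lt_le_trans lo0 X0.
have hB := bdd_between hb.
have : E (fun k => ln (h k)) <= E (fun k => (ln (E h) - 1) + (E h)^-1 * h k).
  apply: (expect_le EE).
  - by apply: bdd_between => k; exact: ln_between lo0 (hb k).
  - by apply: bddD; [exact: bdd_cst|exact: bddZ].
  move=> k; have hk : 0 < h k.
    by have /andP[+ _] := hb k; exact: lt_le_trans.
  move: (E h) X0 (h k) hk => X X0 y y0.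
  have := @le_ln1Dx R (y / X - 1).
  rewrite subrKC ltrBrDl subrr divr_gt0// ln_div ?posrE// => /(_ isT).
  by rewrite mulrC; lra.
move=> /le_trans; apply.
rewrite (expectD EE (bdd_cst _) (bddZ _ hB)) (expectZ EE _ hB) (expect_cst EE).
by rewrite mulVf ?gt_eqF// subrK.
Qed.

(** After times t2 and t1 both functions are measured by their geometric means,
    and the geometric mean of a product is the product of geometric means. *)
Lemma semigroup_two_function (t1 t2 lo hi p r : R) (f g : nat -> R) :
  0 <= t1 -> 0 <= t2 -> 0 < p -> p < 1 -> 0 < r -> r < 1 ->
  expR (- t1) <= 2 * (1 - p) / (2 - p) ->
  expR (- t2) <= 2 * (1 - r) / (2 - r) ->
  0 < lo -> (forall k, lo <= f k <= hi) -> (forall k, lo <= g k <= hi) ->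
  E (fun k => f k `^ r) `^ r^-1 * E (fun k => g k `^ p) `^ p^-1 <=
  E (fun k => T t2 f k * T t1 g k).
Proof.
move=> t10 t20 p0 p1 r0 r1 x1 x2 lo0 fb gb.
have Fb := bdd_semigroup P t2 fb.
have Gb := bdd_semigroup P t1 gb.
have hi0 : 0 < hi by have /andP[h1 h2] := fb 0%N; lra.
have hb k : lo * lo <= T t2 f k * T t1 g k <= hi * hi.
  have /andP[h1 h2] := Fb k; have /andP[h3 h4] := Gb k.
  by rewrite !ler_pM// ?(ltW lo0)// ?(le_trans _ h1) ?(le_trans _ h3) ?(ltW lo0).
have ll0 : 0 < lo * lo by rewrite mulr_gt0.
have h1 := log_hypercontractive lam0 PQ t20 r0 r1 x2 lo0 fb.
have h2 := log_hypercontractive lam0 PQ t10 p0 p1 x1 lo0 gb.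
have h3 := log_mean_le ll0 hb.
have f0 := powR_gt0 r^-1 (expect_powR_gt0 lam r lo0 fb).
have g0 := powR_gt0 p^-1 (expect_powR_gt0 lam p lo0 gb).
have /andP[+ _] := expect_bounds EE hb; move=> /(lt_le_trans ll0) X0.
have lnM_ k : ln (T t2 f k * T t1 g k) = ln (T t2 f k) + ln (T t1 g k).
  have /andP[k1 _] := Fb k; have /andP[k2 _] := Gb k.
  by rewrite lnM ?posrE// (lt_le_trans lo0).
have h4 : E (fun k => ln (T t2 f k * T t1 g k)) =
   E (fun k => ln (T t2 f k)) + E (fun k => ln (T t1 g k)).
  under eq_Rintegral do rewrite lnM_.
  apply: (expectD EE); apply: bdd_between => k.
    exact: ln_between lo0 (Fb k).
  exact: ln_between lo0 (Gb k).
move: (E (fun k => f k `^ r) `^ r^-1) (E (fun k => g k `^ p) `^ p^-1)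
  (E (fun k => T t2 f k * T t1 g k)) f0 g0 X0 h1 h2 h3
  => F G X F0 G0 X0 h1 h2 h3.
have FG0 := mulr_gt0 F0 G0.
rewrite -[F * G]lnK ?posrE// -[X]lnK ?posrE// ler_expR lnM ?posrE//.
by apply: le_trans h3; rewrite h4 lerD.
Qed.

End two_sets.

Lemma shifted_product_le (R : realType) (a b e e' : R) : 0 <= a <= 1 ->
  0 <= b <= 1 -> 0 < e -> e <= 1 -> 3 * e <= e' ->
  (a + e) * (b + e) <= a * b + e'.
Proof.
move=> /andP[a0 a1] /andP[b0 b1] e0 e1 e3.
have : e * a <= e * 1 by rewrite ler_pM2l.
have : e * b <= e * 1 by rewrite ler_pM2l.
have : e * e <= e * 1 by rewrite ler_pM2l.
lra.
Qed.

Lemma product_ge (R : realType) (a b : R) : 0 <= a <= 1 -> 0 <= b <= 1 ->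
  a + b + -1 <= a * b.
Proof.
move=> /andP[a0 a1] /andP[b0 b1].
have : 0 <= (1 - a) * (1 - b) by rewrite mulr_ge0 ?subr_ge0.
lra.
Qed.

Lemma integral_le_partial_sums (R : realType) (nu : probability nat R)
    (h : nat -> R) (Q : R) :
  (forall k, 0 <= h k <= 1) ->
  (forall N, \sum_(k < N) h k * pmf nu k <= Q) -> \int[nu]_k h k <= Q.
Proof.
move=> hb hQ.
have h1 k : `|h k| <= 1 by have /andP[h0 ?] := hb k; rewrite ger0_norm.
have bound N : \int[nu]_k h k <= Q + (1 - \sum_(k < N) pmf nu k).
  have := expect_tail (integral_expectation nu) N h1.
  under eq_bigr do rewrite integral_point.
  under [X in _ <= _ * (_ - X)]eq_bigr do rewrite integral_point.
  move=> /(le_trans (ler_norm _)); rewrite mul1r lerBlDr => /le_trans; apply.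
  by rewrite addrC lerD2r hQ.
have lim : Q + (1 - \sum_(k < N) pmf nu k) @[N --> \oo] --> Q + (1 - 1).
  by apply: cvgD; [exact: cvg_cst|apply: cvgB; [exact: cvg_cst|exact: pmf_mass]].
rewrite -[leRHS]addr0 -(subrr 1).
by apply: (cvgr_to_ge lim); apply: nearW => N; exact: bound.
Qed.

Section sets.
Context {R : realType} (lam : R) (P : R -> nat -> probability nat R).
Hypotheses (lam0 : 0 < lam) (PQ : qqinf_transition lam P).

Local Notation E := (Rintegral (Poi lam) setT).
Local Notation T := (semigroup P).

Let EE : expectation E. Proof. exact: integral_expectation. Qed.

Lemma indic_between (A : set nat) k : 0 <= (\1_A k : R) <= 1.
Proof. by rewrite indicE; case: (k \in A); rewrite ?lexx ?ler01. Qed.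

Lemma bdd_indic (A : set nat) : bdd (\1_A : nat -> R).
Proof. exact: bdd_between (indic_between A). Qed.

Lemma semigroup_indic t k (B : set nat) :
  T t (\1_B : nat -> R) k = fine (P t k B).
Proof. exact: integral_indic. Qed.

Lemma semigroup_comp_indic (s t : R) (B : set nat) k : 0 <= s -> 0 <= t ->
  T s (T t (\1_B : nat -> R)) k = T (s + t) (\1_B : nat -> R) k.
Proof.
move=> s0 t0; rewrite semigroup_indic (chapman_kolmogorov_real PQ)//.
by apply: eq_Rintegral => i _; exact: semigroup_indic.
Qed.

(** By reversibility and the semigroup property the right-hand side is the mean
    of the product of T t2 (\1_A) and T t1 (\1_B). Adding e to both indicators
    makes [semigroup_two_function] applicable, at a cost of at most 3 e. *)
Lemma two_sets_inequality (t1 t2 p r : R) (A B : set nat) :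
  0 <= t1 -> 0 <= t2 -> 0 < p -> p < 1 -> 0 < r -> r < 1 ->
  expR (- t1) <= 2 * (1 - p) / (2 - p) ->
  expR (- t2) <= 2 * (1 - r) / (2 - r) ->
  fine (Poi lam A) `^ r^-1 * fine (Poi lam B) `^ p^-1 <=
  E (fun k => \1_A k * T (t2 + t1) (\1_B : nat -> R) k).
Proof.
move=> t10 t20 p0 p1 r0 r1 x1 x2; apply/ler_addgt0Pr => e' e'0.
pose e := Num.min 1 (e' / 3).
have e0 : 0 < e by rewrite lt_min ltr01 divr_gt0.
have e1 : e <= 1 by rewrite ge_min lexx.
have e3 : 3 * e <= e'.
  by rewrite mulrC -ler_pdivlMr// ge_min lexx orbT.
clearbody e.
pose f (C : set nat) k : R := \1_C k + e.
have fb C k : e <= f C k <= 1 + e.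
  by have /andP[h1 h2] := indic_between C k; rewrite lerDr h1 lerD2r h2.
have H := semigroup_two_function lam0 PQ t10 t20 p0 p1 r0 r1 x1 x2 e0 (fb A) (fb B).
have norm_le s C : 0 < s ->
    fine (Poi lam C) `^ s^-1 <= E (fun k => f C k `^ s) `^ s^-1.
  move=> s0; apply: le_trans (powR_norm_shift_le lam e0 s0 (indic_between C)).
  rewrite le_eqVlt; apply/orP; left; apply/eqP; congr (_ `^ _).
  rewrite -integral_indic; apply: eq_Rintegral => k _; rewrite indicE.
  by case: (k \in C); rewrite ?powR1// powR0// gt_eqF.
have := ler_pM (powR_ge0 _ _) (powR_ge0 _ _) (norm_le r A r0) (norm_le p B p0).
move=> /le_trans /(_ H) /le_trans; apply.
have Tf s C k : T s (f C) k = T s (\1_C : nat -> R) k + e.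
  exact: semigroup_shift (indic_between C).
have Tb s C := bdd_semigroup P s (fb C).
have Ib s C := bdd_semigroup P s (indic_between C).
under eq_Rintegral do rewrite mulrC.
rewrite (semigroup_symmetric lam0 PQ t20 (bdd_between (Tb t1 B)) (bdd_between (fb A))).
have TT k : T t2 (T t1 (f B)) k = T (t2 + t1) (\1_B : nat -> R) k + e.
  rewrite -semigroup_comp_indic// -(semigroup_shift P t2 e k (Ib t1 B)).
  by congr (T t2 _ k); apply/funext => i; exact: Tf.
have AB : bdd (fun k => \1_A k * T (t2 + t1) (\1_B : nat -> R) k).
  by apply: bddM; [exact: bdd_indic|exact: bdd_between (Ib _ _)].
have -> : E (fun k => \1_A k * T (t2 + t1) (\1_B : nat -> R) k) + e' =
    E (fun k => \1_A k * T (t2 + t1) (\1_B : nat -> R) k + e').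
  transitivity (E (fun k => \1_A k * T (t2 + t1) (\1_B : nat -> R) k) + E (fun=> e')).
    by congr (_ + _); rewrite (expect_cst EE).
  by rewrite -(expectD EE AB (bdd_cst e')).
apply: (expect_le EE).
- apply: bddM; first exact: bdd_between (fb A).
  by rewrite (funext TT); apply: bddD; [exact: bdd_between (Ib _ _)|exact: bdd_cst].
- by apply: bddD => //; exact: bdd_cst.
move=> k; rewrite TT /f.
exact: shifted_product_le (indic_between A k) (Ib (t2 + t1) B k) e0 e1 e3.
Qed.

(** This replaces [two_sets_inequality] when one of the sets has full measure:
    the optimal exponent of that set would be 0. *)
Lemma full_measure_bound (t : R) (A B : set nat) : 0 <= t ->
  fine (Poi lam A) + fine (Poi lam B) - 1 <=
  E (fun k => \1_A k * T t (\1_B : nat -> R) k).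
Proof.
move=> t0.
have Ib := bdd_semigroup P t (indic_between B).
have Tbd := bdd_between Ib.
have e1 : E (T t (\1_B : nat -> R)) = fine (Poi lam B).
  transitivity (E (fun k => 1 * T t (\1_B : nat -> R) k)).
    by apply: eq_Rintegral => k _; rewrite mul1r.
  rewrite (semigroup_symmetric lam0 PQ t0 (bdd_cst 1) (bdd_indic B)).
  rewrite -integral_indic; apply: eq_Rintegral => k _.
  have -> : T t (fun=> 1) k = 1.
    exact: (expect_cst (integral_expectation (P t k)) 1).
  by rewrite mulr1.
have -> : fine (Poi lam A) + fine (Poi lam B) - 1 =
    E (fun k => (\1_A k + T t (\1_B : nat -> R) k) + -1).
  rewrite (expectD EE (bddD (bdd_indic A) Tbd) (bdd_cst _)).
  by rewrite (expectD EE (bdd_indic A) Tbd) (expect_cst EE) e1 integral_indic.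
apply: (expect_le EE).
- by apply: bddD; [exact: bddD (bdd_indic A) Tbd|exact: bdd_cst].
- exact: bddM (bdd_indic A) Tbd.
by move=> k; exact: product_ge (indic_between A k) (Ib k).
Qed.

(** The Markov property gives the joint law at pairs of points; countable
    additivity in the second and then in the first coordinate does the rest. *)
Lemma joint_law_ge (d : measure_display) (Omega : measurableType d)
    (Pr : probability Omega R) (Y : R -> {RV Pr >-> nat}) (t : R)
    (A B : set nat) :
  markov_chain P Y ->
  (forall A : set nat, distribution Pr (Y 0) A = Poi lam A) -> 0 < t ->
  ((E (fun k => \1_A k * T t (\1_B : nat -> R) k))%:E <=
   Pr ((Y 0%R @^-1` A) `&` (Y t @^-1` B)))%E.
Proof.
move=> Ym Y0 t0.
have mY s (C : set nat) : measurable (Y s @^-1` C).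
  by rewrite -[_ @^-1` _]setTI; exact: measurable_funPT.
have point k j : Pr ((Y 0%R @^-1` [set k]) `&` (Y t @^-1` [set j])) =
    (Poi lam [set k] * P t k [set j])%E.
  pose s m := if m is 0%N then 0 else t.
  pose x m := if m is 0%N then k else j.
  have := Ym 0%N s x (lexx _).
  rewrite !bigcap_mkord !big_ord_recl !big_ord0 !setIT /= subr0 => -> //.
    by congr (_ * _)%E; rewrite -Y0.
  by move=> [|m] _ //; exact: ltW.
have split_preimage s (C : set nat) (F : set Omega) : measurable F ->
    Pr ((Y s @^-1` C) `&` F) =
    (\sum_(k <oo | k \in C) Pr ((Y s @^-1` [set k]) `&` F))%E.
  move=> mF; rewrite -measure_bigcup.
  - congr (Pr _); apply/seteqP; split=> w /=.
      by move=> [Cw Fw]; exists (Y s w).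
    by move=> [k Ck [/= Yk Fw]]; split=> //; rewrite Yk.
  - by move=> k _; exact: measurableI.
  - by move=> k l _ _ [w [[/= <- _] [/= <- _]]].
have row k : Pr ((Y 0%R @^-1` [set k]) `&` (Y t @^-1` B)) =
    (Poi lam [set k] * P t k B)%E.
  rewrite setIC split_preimage; last exact: mY.
  have -> : P t k B = (\sum_(j <oo | j \in B) P t k [set j])%E.
    rewrite -measure_bigcup//; last by move=> a b _ _ [c [/= <- <-]].
    by rewrite bigcup_imset1 image_id.
  have -> : Poi lam [set k] = (pmf (Poi lam) k)%:E.
    by rewrite /pmf fineK// fin_num_measure.
  rewrite -nneseriesZl//; apply: eq_eseriesr => j _.
  by rewrite setIC point /pmf fineK// fin_num_measure.
have fin_pr : Pr ((Y 0%R @^-1` A) `&` (Y t @^-1` B)) \is a fin_num.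
  by apply: fin_num_measure; exact: measurableI.
rewrite -(fineK fin_pr) lee_fin.
have hb k : 0 <= \1_A k * T t (\1_B : nat -> R) k <= 1.
  have /andP[a0 a1] := indic_between A k.
  have /andP[b0 b1] := bdd_semigroup P t (indic_between B) k.
  by rewrite mulr_ge0//= mulr_ile1.
have partial N : \sum_(k < N) (\1_A k * T t (\1_B : nat -> R) k) * pmf (Poi lam) k <=
    fine (Pr ((Y 0%R @^-1` A) `&` (Y t @^-1` B))).
  rewrite -lee_fin (fineK fin_pr) split_preimage; last exact: mY.
  apply: le_trans (nneseries_lim_ge N _); last by [].
  rewrite -sumEFin big_mkord [leRHS]big_mkcond/=; apply: lee_sum => k _.
  rewrite indicE; case: ifP => kA; last by rewrite !mul0r.
  rewrite row mul1r semigroup_indic EFinM muleC.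
  by rewrite !fineK// ?fin_num_measure.
exact: (integral_le_partial_sums hb partial).
Qed.

End sets.

(** Here s ^ 2 = exp (- t), and u stands for exp (- t1), v for exp (- t2), so
    u v = s ^ 2. The exponent p = (2 - 2 u) / (2 - u) is the largest one that
    time t1 takes to exponent 0, and it has 1 / p = (1 + 1 / (1 - u)) / 2. The
    chosen u minimises a ^ 2 / (1 - v) + b ^ 2 / (1 - u) under the constraint
    u v = s ^ 2. *)
Lemma optimal_exponents (R : realType) (a b s : R) :
  0 < a -> 0 < b -> 0 < s -> s < 1 ->
  let u := s * (a + s * b) / (b + s * a) in
  [/\ 0 < u, u < 1, 0 < (2 - 2 * u) / (2 - u), (2 - 2 * u) / (2 - u) < 1 &
      u <= 2 * (1 - (2 - 2 * u) / (2 - u)) / (2 - (2 - 2 * u) / (2 - u))].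
Proof.
move=> a0 b0 s0 s1; set w := _ / _ => u.
have ba0 : 0 < b + s * a by rewrite addr_gt0 ?mulr_gt0.
have ab0 : 0 < a + s * b by rewrite addr_gt0 ?mulr_gt0.
have u0 : 0 < u by rewrite divr_gt0 ?mulr_gt0.
have u1 : u < 1.
  rewrite ltr_pdivrMr// mul1r mulrDr addrC ltrD2r mulrA -[ltRHS]mul1r ltr_pM2r//.
  by rewrite mulr_ilt1// ltW.
clearbody u; split=> //.
- by rewrite divr_gt0//; lra.
- by rewrite ltr_pdivrMr; lra.
- rewrite le_eqVlt; apply/orP; left; apply/eqP; field.
  by apply/andP; split; rewrite gt_eqF//; lra.
Qed.

Lemma optimal_exponent_value (R : realType) (a b s : R) :
  0 < a -> 0 < b -> 0 < s -> s < 1 ->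
  let u := s * (a + s * b) / (b + s * a) in
  let v := s * (b + s * a) / (a + s * b) in
  a ^+ 2 / 2 / ((2 - 2 * v) / (2 - v)) + b ^+ 2 / 2 / ((2 - 2 * u) / (2 - u)) =
  ((2 - s ^+ 2) * (a ^+ 2 + b ^+ 2) + 2 * s * a * b) / (4 * (1 - s ^+ 2)).
Proof.
move=> a0 b0 s0 s1 u v.
have ba0 : 0 < b + s * a by rewrite addr_gt0 ?mulr_gt0.
have ab0 : 0 < a + s * b by rewrite addr_gt0 ?mulr_gt0.
have s2 : 0 < 1 - s ^+ 2 by rewrite subr_gt0 expr_lt1// ltW.
have uE : 1 - u = (1 - s ^+ 2) * b / (b + s * a).
  by rewrite /u; field; rewrite gt_eqF.
have vE : 1 - v = (1 - s ^+ 2) * a / (a + s * b).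
  by rewrite /v; field; rewrite gt_eqF.
have pE (w : R) : w < 1 -> ((2 - 2 * w) / (2 - w))^-1 = (1 + (1 - w)^-1) / 2.
  by move=> w1; field; rewrite !gt_eqF//; lra.
have u1 : u < 1 by rewrite -subr_gt0 uE divr_gt0 ?mulr_gt0.
have v1 : v < 1 by rewrite -subr_gt0 vE divr_gt0 ?mulr_gt0.
rewrite (pE _ u1) (pE _ v1) uE vE; field.
by rewrite !gt_eqF.
Qed.

Theorem mainTheorem12 (R : realType) (lam : R) (lam_gt0 : 0 < lam)
    (P : R -> nat -> probability nat R) (P_qqinf : qqinf_transition lam P) :
  (forall (f : nat -> R) (p q t : R),
      (forall k : nat, 0 <= f k) -> (exists M : R, forall k : nat, f k <= M) ->
      0 <= q -> q < p -> p < 1 ->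
      ln (((1 - q) * (2 - p)) / ((1 - p) * (2 - q))) <= t ->
      (Lp (Poi lam) p f <= Lp (Poi lam) q (semigroup P t f))%E)
  /\
  (forall (d : measure_display) (Omega : measurableType d)
      (Pr : probability Omega R) (Y : R -> {RV Pr >-> nat}),
      markov_chain P Y ->
      (forall A : set nat, distribution Pr (Y 0) A = Poi lam A) ->
      forall (a b : R) (A B : set nat), 0 <= a -> 0 <= b ->
      Poi lam A = (expR (- (a ^+ 2 / 2)))%:E ->
      Poi lam B = (expR (- (b ^+ 2 / 2)))%:E ->
      forall t : R, 0 < t ->
      ((expR (- (((2 - expR (- t)) * (a ^+ 2 + b ^+ 2)
                  + 2 * expR (- t / 2) * a * b)
                 / (4 * (1 - expR (- t))))))%R%:E
        <= Pr ((Y 0%R @^-1` A) `&` (Y t @^-1` B)))%E).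
Proof.
split=> [f p q t f0 fM q0 qp p1 zt|].
  exact: reverse_hypercontractivity.
move=> d Omega Pr Y Ym Y0 a b A B a0 b0 PA PB t t0.
apply: le_trans (joint_law_ge A B Ym Y0 t0).
rewrite lee_fin.
have fA : fine (Poi lam A) = expR (- (a ^+ 2 / 2)) by rewrite PA.
have fB : fine (Poi lam B) = expR (- (b ^+ 2 / 2)) by rewrite PB.
pose s := expR (- t / 2).
have s0 : 0 < s by exact: expR_gt0.
have s1 : s < 1 by rewrite expR_lt1 mulNr oppr_lt0 divr_gt0.
have sE : expR (- t) = s ^+ 2 by rewrite /s -expRM_natl; congr expR; field.
have s2 : 0 < 1 - s ^+ 2 by rewrite subr_gt0 expr_lt1// ltW.
rewrite sE -/s.
have full c : c ^+ 2 / 2 <= (2 - s ^+ 2) * c ^+ 2 / (4 * (1 - s ^+ 2)).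
  rewrite -subr_ge0.
  have -> : (2 - s ^+ 2) * c ^+ 2 / (4 * (1 - s ^+ 2)) - c ^+ 2 / 2 =
    s ^+ 2 * c ^+ 2 / (4 * (1 - s ^+ 2)) by field; rewrite gt_eqF.
  apply: divr_ge0; apply: mulr_ge0 => //; [exact: sqr_ge0|exact: sqr_ge0|].
  exact: ltW.
have bonf := full_measure_bound lam_gt0 P_qqinf A B (ltW t0).
rewrite fA fB in bonf.
move: a0; rewrite le_eqVlt => /predU1P[a0|a0].
  apply: le_trans bonf; rewrite -a0 expr0n /= !mul0r oppr0 expR0 mulr0 mul0r.
  rewrite addr0 add0r [leRHS]addrAC subrr add0r ler_expR lerN2; exact: full.
move: b0; rewrite le_eqVlt => /predU1P[b0|b0].
  apply: le_trans bonf; rewrite -b0 expr0n /= mul0r oppr0 expR0 mulr0.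
  by rewrite !addr0 addrK ler_expR lerN2 full.
have [] := optimal_exponents a0 b0 s0 s1.
have [] := optimal_exponents b0 a0 s0 s1.
have := optimal_exponent_value a0 b0 s0 s1.
set u := s * (a + s * b) / (b + s * a); set v := s * (b + s * a) / (a + s * b).
have uv : v * u = s ^+ 2.
  by rewrite /u /v; field; rewrite !gt_eqF// addr_gt0 ?mulr_gt0.
set p := (2 - 2 * u) / (2 - u); set r := (2 - 2 * v) / (2 - v).
move=> <- v0 v1 r0 r1 vr u0 u1 p0 p1 up.
have lnN (y : R) : 0 < y -> y < 1 -> 0 <= - ln y /\ expR (- - ln y) = y.
  by move=> y0 y1; rewrite opprK lnK ?posrE// oppr_ge0 ln_le0 ?(ltW y1).
have [t10 x1] := lnN _ u0 u1; have [t20 x2] := lnN _ v0 v1.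
rewrite -x1 in up; rewrite -x2 in vr.
have := two_sets_inequality lam_gt0 P_qqinf A B t10 t20 p0 p1 r0 r1 up vr.
have -> : - ln v + - ln u = t.
  by rewrite -opprD -lnM ?posrE// uv -sE expRK opprK.
apply: le_trans; rewrite fA fB -!expRM -expRD ler_expR.
by rewrite !mulNr opprD.
Qed.
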